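(* Let $E$ be a finite acyclic directed graph, let $k$ be a positive integer, and let $\mathbb{Z}/k$ act on $C^*(E)$ by the restriction of the gauge action. Then $$\mathrm{dim}^{\mathbb{Z}/k}_{\mathrm{WLT}}(C^*(E))=\max_{v\text{ a sink of }E}\left(\mathrm{quot}^v-1\right).$$
   Context: A directed graph is $E=(E^0,E^1,r,s)$ with vertex set $E^0$, edge set $E^1$, and range and source maps $r,s:E^1\to E^0$; finite means $E^0$ and $E^1$ are finite. A sink is a vertex emitting no edges. A path of length $m\ge 1$ is a sequence of edges $e_1\cdots e_m$ with $r(e_j)=s(e_{j+1})$; paths of length $0$ are the vertices. $C^*(E)$ is the universal $C^*$-algebra generated by mutually orthogonal projections $P_v$ ($v\in E^0$) and partial isometries $S_e$ ($e\in E^1$) with mutually orthogonal ranges such that $S_e^*S_e=P_{r(e)}$, $S_eS_e^*\le P_{s(e)}$, and $P_v=\sum_{e\in s^{-1}(v)}S_eS_e^*$ whenever $s^{-1}(v)$ is nonempty and finite. The gauge action of $\mathbb{S}^1$ is $S_e\mapsto\lambda S_e$, $P_v\mapsto P_v$ for $\lambda\in\mathbb{S}^1$; $\mathbb{Z}/k$ is identified with the $k$th roots of unity in $\mathbb{S}^1$. For a sink $v$ and a residue $i\in\{0,\ldots,k-1\}$, $\#^v_i$ is the number of directed paths in $E$ (including the length-$0$ path $v$) that end at $v$ and have length congruent to $i$ modulo $k$. Define $$\mathrm{quot}^v:=\left\lceil\frac{\max_i\#^v_i}{\min_j\#^v_j}\right\rceil,$$ with value $\infty$ if the denominator is $0$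 (and $\infty-1=\infty$). Weak local-triviality dimension: let a compact group $G$ act on a unital $C^*$-algebra $A$. Equip $C(G)$ with $(\alpha_gf)(h)=f(hg)$ and $C_0((0,1])\otimes C(G)$ with the action on the second factor, and let $t$ be the identity function in $C_0((0,1])$. $\mathrm{dim}^G_{\mathrm{WLT}}(A)$ is the smallest $n\ge0$ for which there exist $G$-equivariant $*$-homomorphisms $\rho_0,\ldots,\rho_n:C_0((0,1])\otimes C(G)\to A$ such that $\sum_{i=0}^n\rho_i(t\otimes1)$ is invertible ($\infty$ if no such $n$ exists). *)

(* Defs.v *)
From HB Require Import structures.
From mathcomp Require Import all_boot all_order all_algebra all_fingroup.
From mathcomp Require Import all_classical all_reals all_analysis.
From mathcomp Require Import complex finmap.

Set Implicit Arguments.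
Unset Strict Implicit.
Unset Printing Implicit Defensive.

Import Order.TTheory GRing.Theory Num.Theory numFieldNormedType.Exports.

Local Open Scope classical_set_scope.
Local Open Scope ring_scope.

Reserved Notation "x ** y" (at level 40, left associativity).

(* Algebras are not assumed to have a unit and *-homomorphisms are not assumed
   to preserve one: C_0((0,1]) tensor C(G) is not unital. *)
HB.mixin Record Lmodule_isStarAlgebra (C : numClosedFieldType) A
    & GRing.Lmodule C A := {
  amul : A -> A -> A ;
  star : A -> A ;
  amulA : associative amul ;
  amulDl : left_distributive amul +%R ;
  amulDr : right_distributive amul +%R ;
  amulZl : forall (a : C) x y, amul (a *: x) y = a *: amul x y ;
  amulZr : forall (a : C) x y, amul x (a *: y) = a *: amul x y ;
  starK : involutive star ;
  starD : {morph star : x y / x + y} ;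
  starM : forall x y, star (amul x y) = amul (star y) (star x) ;
  starZ : forall (a : C) x, star (a *: x) = a^* *: star x }.

#[short(type="starAlgType")]
HB.structure Definition StarAlgebra (C : numClosedFieldType) :=
  {A of GRing.Lmodule C A & Lmodule_isStarAlgebra C A}.

Notation "x ** y" := (amul x y) : ring_scope.

HB.mixin Record StarAlgebra_isCStar (C : numClosedFieldType) A
    & CompleteNormedModule C A & StarAlgebra C A := {
  ler_normaM : forall x y : A, `|x ** y| <= `|x| * `|y| ;
  cstar_identity : forall x : A, `|star x ** x| = `|x| ^+ 2 }.

#[short(type="cstarAlgType")]
HB.structure Definition CStarAlgebra (C : numClosedFieldType) :=
  {A of CompleteNormedModule C A & StarAlgebra C A & StarAlgebra_isCStar C A}.

Section StarAlgebraTheory.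
Variable C : numClosedFieldType.

Definition is_star_hom (A B : starAlgType C) (f : A -> B) : Prop :=
  [/\ forall x y, f (x + y) = f x + f y,
      forall (a : C) x, f (a *: x) = a *: f x,
      forall x y, f (x ** y) = f x ** f y &
      forall x, f (star x) = star (f x)].

Definition is_unit (A : starAlgType C) (u : A) : Prop :=
  forall x, u ** x = x /\ x ** u = x.

Definition is_invertible (A : starAlgType C) (x : A) : Prop :=
  exists2 u : A, is_unit u & exists y, x ** y = u /\ y ** x = u.

Definition is_projection (A : starAlgType C) (p : A) : Prop :=
  star p = p /\ p ** p = p.

Definition is_partial_isometry (A : starAlgType C) (s : A) : Prop :=
  s ** star s ** s = s.

Definition cstar_le (A : cstarAlgType C) (x y : A) : Prop :=
  exists z : A, y - x = star z ** z.

Definition is_cstar_subalgebra (A : cstarAlgType C) (D : set A) : Prop :=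
  [/\ closed D, D 0,
      forall x y, D x -> D y -> D (x + y) /\ D (x ** y) &
      forall (a : C) x, D x -> D (a *: x) /\ D (star x)].

Definition cstar_generated_by (A : cstarAlgType C) (X : set A) : Prop :=
  forall D : set A, is_cstar_subalgebra D -> X `<=` D -> D = setT.

End StarAlgebraTheory.

Record digraph := Digraph {
  vertex : finType ;
  edge : finType ;
  src : edge -> vertex ;
  rng : edge -> vertex }.

Section Digraph.
Variable E : digraph.

Fixpoint is_walk (v : vertex E) (p : seq (edge E)) (w : vertex E) : bool :=
  if p is e :: p' then (src e == v) && is_walk (rng e) p' w else v == w.

Definition is_sink (v : vertex E) : bool := [forall e, src e != v].

Definition acyclic : Prop :=
  forall (v : vertex E) (p : seq (edge E)), is_walk v p v -> p = [::].

(* A path is recorded with its initial vertex, so that (v, [::]) is the path of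
   length 0 at v. *)
Definition paths_to (k : nat) (v : vertex E) (i : nat) :
    set (vertex E * seq (edge E)) :=
  [set q | is_walk q.1 q.2 v /\ size q.2 = i %[mod k]].

(* Meaningful when paths_to k v i is finite, as it is for acyclic E. *)
Definition num_paths_to (k : nat) (v : vertex E) (i : nat) : nat :=
  #|` fset_set (paths_to k v i)|.

Definition max_paths (k : nat) (v : vertex E) : nat :=
  (\max_(i < k) num_paths_to k v i)%N.
(* The index 0 is one of the residues, since k > 0. *)
Definition min_paths (k : nat) (v : vertex E) : nat :=
  \big[minn/num_paths_to k v 0]_(i < k) num_paths_to k v i.

(* The case split gives +oo for a zero denominator, where x / 0 = 0. *)
Definition quot (R : realType) (k : nat) (v : vertex E) : \bar R :=
  if min_paths k v == 0%N then +oo%E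
  else (Num.ceil ((max_paths k v)%:R / (min_paths k v)%:R : R))%:~R%:E.

End Digraph.

Section GraphAlgebra.
Variables (R : realType) (E : digraph).

Definition is_CK_family (A : cstarAlgType R[i])
    (P : vertex E -> A) (S : edge E -> A) : Prop :=
  [/\ (forall v, is_projection (P v)) /\
        (forall v w, v != w -> P v ** P w = 0),
      (forall e, is_partial_isometry (S e)) /\
        (forall e f, e != f ->
           (S e ** star (S e)) ** (S f ** star (S f)) = 0),
      forall e, star (S e) ** S e = P (rng e),
      forall e, cstar_le (S e ** star (S e)) (P (src e)) &
      forall v, (exists e, src e = v) ->
        P v = \sum_(e | src e == v) S e ** star (S e)].

Definition is_graph_algebra (A : cstarAlgType R[i])
    (P : vertex E -> A) (S : edge E -> A) : Prop :=
  [/\ is_CK_family P S,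
      cstar_generated_by ([set P v | v in setT] `|` [set S e | e in setT]) &
      forall (B : cstarAlgType R[i]) (Q : vertex E -> B) (T : edge E -> B),
        is_CK_family Q T ->
        exists phi : A -> B,
          [/\ is_star_hom phi, forall v, phi (P v) = Q v &
              forall e, phi (S e) = T e]].

(* An action of the circle group; gamma z is unconstrained when |z| <> 1. *)
Definition is_gauge_action (A : cstarAlgType R[i])
    (P : vertex E -> A) (S : edge E -> A) (gamma : R[i] -> A -> A) : Prop :=
  [/\ forall z, `|z| = 1 -> is_star_hom (gamma z),
      forall x, gamma 1 x = x,
      forall z w x, `|z| = 1 -> `|w| = 1 ->
        gamma (z * w) x = gamma z (gamma w x) &
      forall z, `|z| = 1 ->
        (forall v, gamma z (P v) = P v) /\
        (forall e, gamma z (S e) = z *: S e)].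

End GraphAlgebra.

Lemma conj_continuous (C : numClosedFieldType) :
  continuous (Num.conj : C^o -> C^o).
Proof.
move=> z; apply/(@cvgrPdist_le _ C^o _ (nbhs z)) => e e0.
apply: filterS (nbhsx_ballx z e e0) => w; rewrite /ball/= => zwe.
by rewrite -rmorphB norm_conjC ltW.
Qed.

Lemma real_complex_continuous (R : realType) :
  continuous (fun s : R => s%:C%C : R[i]^o).
Proof.
move=> s; apply/(@cvgrPdist_lt _ R[i]^o _ (nbhs s)) => e e0.
have eE : e = (complex.Re e)%:C%C by rewrite RRe_real// gtr0_real.
have e0' : 0 < complex.Re e by rewrite -ltcR -eE.
apply: filterS (nbhsx_ballx s _ e0') => w; rewrite /ball/= => swe.
by rewrite -rmorphB normc_def/= expr0n/= addr0 sqrtr_sqr eE ltcR.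
Qed.

(* C_0((0,1]) tensor C(G), for G a finite (hence discrete) group, is
   C_0((0,1] x G).  Its elements are represented by their extensions by 0 to
   R x G: the value at 0 is 0 and the extension is continuous on [0,1], while
   there is no continuity requirement in the variable of G. *)
Section Cone.
Variables (R : realType) (G : finGroupType).

Definition cone_pred (f : R * G -> R[i]^o) : Prop :=
  (forall g, {within `[0, 1], continuous (fun s => f (s, g))}) /\
  (forall s g, ~ (0 < s <= 1) -> f (s, g) = 0).

Definition cone_mem : {pred R * G -> R[i]^o} := fun f => `[< cone_pred f >].


Lemma cone_submod_closed : submod_closed cone_mem.
Proof.
split=> [|a f h]; rewrite /in_mem/= ?/cone_mem.
  by apply/asboolP; split=> // g x; exact: cvg_cst.
move=> /asboolP[cf f0] /asboolP[ch h0]; apply/asboolP; split=> [g|s g sN].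
  move=> x; apply: cvgD; last exact: ch.
  by apply: cvgZr; exact: cf.
have -> : (a *: f + h) (s, g) = a *: f (s, g) + h (s, g) by [].
by rewrite f0// h0// scaler0 addr0.
Qed.
HB.instance Definition _ :=
  GRing.isSubmodClosed.Build R[i] (R * G -> R[i]^o) cone_mem cone_submod_closed.

Record cone := Cone { cone_fun :> R * G -> R[i]^o ; _ : cone_fun \in cone_mem }.
HB.instance Definition _ := [isSub for cone_fun].
HB.instance Definition _ := [Choice of cone by <:].
HB.instance Definition _ := [SubChoice_isSubLmodule of cone by <:].

Lemma coneP (f : cone) : cone_pred f.
Proof. by case: f => f /= /asboolP. Qed.

Definition mk_cone (f : R * G -> R[i]^o) (Hf : cone_pred f) : cone :=
  @Cone f (asboolT Hf).

Lemma cone_mul_subproof (f h : cone) :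
  cone_pred (fun x => (f x : R[i]) * h x).
Proof.
have [[cf f0] [ch h0]] := (coneP f, coneP h); split=> [g|s g sN]; last first.
  by rewrite f0// mul0r.
by move=> x; apply: cvgM; [exact: cf|exact: ch].
Qed.

Lemma cone_star_subproof (f : cone) : cone_pred (fun x => (f x : R[i])^*).
Proof.
have [cf f0] := coneP f; split=> [g|s g sN]; last by rewrite f0// rmorph0.
move=> x.
exact: (cvg_comp _ _ (cf g x) (@conj_continuous R[i] (f (x, g)))).
Qed.

Definition cone_mul (f h : cone) : cone := mk_cone (cone_mul_subproof f h).
Definition cone_star (f : cone) : cone := mk_cone (cone_star_subproof f).

Lemma cone_mulA : associative cone_mul.
Proof. by move=> f g h; apply/val_inj/funext => x /=; rewrite mulrA. Qed.
Lemma cone_mulDl : left_distributive cone_mul +%R.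
Proof. by move=> f g h; apply/val_inj/funext => x /=; rewrite mulrDl. Qed.
Lemma cone_mulDr : right_distributive cone_mul +%R.
Proof. by move=> f g h; apply/val_inj/funext => x /=; rewrite mulrDr. Qed.
Lemma cone_mulZl (a : R[i]) f h : cone_mul (a *: f) h = a *: cone_mul f h.
Proof. by apply/val_inj/funext => x; exact: esym (mulrA _ _ _). Qed.
Lemma cone_mulZr (a : R[i]) f h : cone_mul f (a *: h) = a *: cone_mul f h.
Proof. by apply/val_inj/funext => x; exact: mulrCA. Qed.
Lemma cone_starK : involutive cone_star.
Proof. by move=> f; apply/val_inj/funext => x /=; rewrite conjCK. Qed.
Lemma cone_starD : {morph cone_star : f h / f + h}.
Proof. by move=> f h; apply/val_inj/funext => x /=; rewrite rmorphD. Qed.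
Lemma cone_starM f h :
  cone_star (cone_mul f h) = cone_mul (cone_star h) (cone_star f).
Proof. by apply/val_inj/funext => x /=; rewrite rmorphM mulrC. Qed.
Lemma cone_starZ (a : R[i]) f : cone_star (a *: f) = a^* *: cone_star f.
Proof. by apply/val_inj/funext => x; exact: rmorphM. Qed.

HB.instance Definition _ := Lmodule_isStarAlgebra.Build R[i] cone
  cone_mulA cone_mulDl cone_mulDr cone_mulZl cone_mulZr
  cone_starK cone_starD cone_starM cone_starZ.

Lemma cone_act_subproof (g : G) (f : cone) :
  cone_pred (fun x => f (x.1, (x.2 * g)%g)).
Proof. by have [cf f0] := coneP f; split=> [h|s h sN] /=; [exact: cf|rewrite f0]. Qed.

Definition cone_act (g : G) (f : cone) : cone := mk_cone (cone_act_subproof g f).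

Lemma cone_id_subproof :
  cone_pred (fun x => if 0 < x.1 <= 1 then (x.1)%:C%C else 0).
Proof.
split=> [g|s g /= /negP/negbTE ->//].
have : {within `[0, 1], continuous (fun s : R => s%:C%C : R[i]^o)}.
  by apply: continuous_subspaceT; exact: real_complex_continuous.
apply: (@subspace_eq_continuous R `[0, 1]%classic R[i]^o) => s.
rewrite mem_setE in_itv/= => /andP[s0 s1].
by rewrite /from_subspace/= s1 andbT; case: ltgtP s0 => // <-.
Qed.

Definition cone_id : cone := mk_cone cone_id_subproof.

End Cone.

(* For k > 0 this is Z/k as a group, including k = 1 (where 'Z_k is Z/2). *)
Notation "'Zmod' k" := 'I_k.-1.+1 (at level 10, only parsing).

Section WLT.
Variables (R : realType) (G : finGroupType) (A : starAlgType R[i]).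

Definition is_equivariant (alpha : G -> A -> A) (rho : cone R G -> A) : Prop :=
  forall g f, rho (cone_act g f) = alpha g (rho f).

Definition wlt_dim_le (alpha : G -> A -> A) (n : nat) : Prop :=
  exists rho : 'I_n.+1 -> cone R G -> A,
    (forall i, is_star_hom (rho i) /\ is_equivariant alpha (rho i)) /\
    is_invertible (\sum_i rho i (cone_id R G)).

(* The infimum of a set of naturals is its least element, and +oo for set0. *)
Definition wlt_dim (alpha : G -> A -> A) : \bar R :=
  ereal_inf [set n%:R%:E | n in wlt_dim_le alpha].

End WLT.

(* Main.v *)
(** C*(E) is spanned by the elements e_ab = S_a S_b^*, for a, b paths ending in a
    common sink v; for a fixed v they are matrix units, and the generator of Z/k
    multiplies e_ab by zeta^(|a| - |b|).

    Lower bound: if n + 1 maps rho_j exist, write rho_j(t) as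
    rho_j(sqrt t * chi^-1) rho_j(sqrt t * chi) for the character chi of weight
    i' - i.  The second factor sends paths of length i mod k to paths of length
    i' mod k, so on the paths of residue i ending at v an inverse of
    sum_j rho_j(t) makes the identity factor through n + 1 copies of the paths of
    residue i', whence #_i <= (n + 1) #_i'.  This needs P_v <> 0, which is where
    the universal property enters, through a representation by matrices.

    Upper bound: a family of k paths with the same end and with lengths
    0, ..., k - 1 mod k gives, by a discrete Fourier transform, an equivariant
    copy of C(Z/k) whose unit is the sum of the corresponding e_aa.  With
    m = min_i #_i, the paths ending at v are covered by n + 1 unions of m disjoint
    such families as soon as max_i #_i <= (n + 1) m. *)

Require Import Defs.
From HB Require Import structures.
From mathcomp Require Import all_boot all_order all_algebra all_fingroup.
From mathcomp Require Import all_classical all_reals all_analysis.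
From mathcomp Require Import complex finmap.

Set Implicit Arguments.
Unset Strict Implicit.
Unset Printing Implicit Defensive.

Import Order.TTheory GRing.Theory Num.Theory numFieldNormedType.Exports.

Local Open Scope ring_scope.

(** * Finite-dimensional closedness *)

Section ComplexComplete.
Local Open Scope classical_set_scope.
Variable R : realType.

(** Real and imaginary parts are 1-Lipschitz, so both images of the filter are Cauchy in [R], which
    is complete. Their limits are the coordinates of the complex limit. *)
Lemma complex_cauchy_cvg (F : set_system R[i]^o) :
  ProperFilter F -> cauchy F -> cvg F.
Proof.
move=> FF /cauchy_ballP cF.
have lip (f : R[i]^o -> R) : (forall x y, f (x - y) = f x - f y) ->
    (forall x, `|f x|%:C%C <= `|x : R[i]|) -> cvg (f @ F).
  move=> fB fle; apply: cauchy_cvg; apply/cauchy_ballP => e e0.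
  rewrite near_map2; have e0' : 0 < e%:C%C by rewrite ltcR.
  apply: filterS (cF _ e0') => -[x y]; rewrite /ball/= => xye.
  by rewrite -ltcR -fB (le_lt_trans (fle _)).
have cRe : cvg ((@complex.Re R : R[i]^o -> R) @ F).
  by apply: lip => [[a b] [c d]//|x]; exact: normc_ge_Re.
have cIm : cvg ((@complex.Im R : R[i]^o -> R) @ F).
  apply: lip => [[a b] [c d]//|[a b]].
  rewrite normc_def/= lecR -sqrtr_sqr ler_sqrt ?addr_ge0 ?sqr_ge0//.
  by rewrite lerDr sqr_ge0.
apply/cvg_ex; exists ((lim ((@complex.Re R : R[i]^o -> R) @ F) +i*
  lim ((@complex.Im R : R[i]^o -> R) @ F))%C : R[i]^o).
apply/cvgrPdist_lt => e e0.
have eE : e = (complex.Re e)%:C%C by rewrite RRe_real// gtr0_real.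
have e20 : 0 < complex.Re e / 2 by rewrite divr_gt0// -ltcR -eE.
move/cvgrPdist_lt : cRe => /(_ _ e20) nRe.
move/cvgrPdist_lt : cIm => /(_ _ e20) nIm.
near=> z.
have zRe : `|lim ((@complex.Re R : R[i]^o -> R) @ F) - complex.Re z| <
  complex.Re e / 2 by near: z.
have zIm : `|lim ((@complex.Im R : R[i]^o -> R) @ F) - complex.Im z| <
  complex.Re e / 2 by near: z.
move: zRe zIm; set a := lim _; set b := lim _ => zRe zIm.
rewrite eE normc_def ltcR.
have -> : complex.Re ((a +i* b)%C - z) = a - complex.Re z by case: (z).
have -> : complex.Im ((a +i* b)%C - z) = b - complex.Im z by case: (z).
rewrite -(@ger0_norm _ (complex.Re e)); last by rewrite ltW// -ltcR -eE.
rewrite -sqrtr_sqr ltr_sqrt ?exprn_even_gt0//; last first.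
  by rewrite /= gt_eqF// -ltcR -eE.
rewrite -(real_normK (num_real (a - _))) -(real_normK (num_real (b - _))).
(* Compare squares: the modulus is at most the sum of the coordinate distances, each below half of
   e. *)
rewrite (le_lt_trans (y := (`|a - complex.Re z| + `|b - complex.Im z|) ^+ 2))//.
  by rewrite sqrrD -addrA [X in _ <= _ + X]addrC addrA lerDl mulrn_wge0// mulr_ge0.
rewrite ltr_sqr ?nnegrE ?addr_ge0//; first by rewrite (splitr (complex.Re e)) ltrD.
by rewrite ltW// -ltcR -eE.
Unshelve. all: by end_near. Qed.

End ComplexComplete.

Section ClosedLine.
Local Open Scope classical_set_scope.
Variables (R : realType) (A : normedModType R[i]).

(** For e nonzero and x in the closure, the sets of scalars c with c e near x generate a proper
    filter. It is Cauchy because c -> c e multiplies distances by the norm of e, and its limit is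
    the coefficient of x. This is what lets one-dimensional corners survive the passage to
    limits. *)
Lemma closed_line (e : A) : closed [set x | exists c : R[i], x = c *: e].
Proof.
have [->|e0] := eqVneq e 0.
  rewrite (_ : mkset _ = [set 0])%classic; last first.
    by apply/seteqP; split=> [x [c ->]|x ->]/=; [rewrite scaler0|exists 0; rewrite scaler0].
  exact/accessible_closed_set1/hausdorff_accessible/norm_hausdorff.
move=> x clx.
pose G : set_system R[i]^o := [set B | exists2 d : R[i], 0 < d &
  [set c : R[i] | `|x - c *: e| < d]%classic `<=` B]%classic.
have ne : 0 < `|e| by rewrite normr_gt0.
have GF : ProperFilter G.
  split.
    move=> [d d0] /= G0.
    have [_ [[c ->] xc]] := clx _ (nbhsx_ballx x d d0).
    by apply: (G0 c); rewrite /=; rewrite -ball_normE in xc.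
  split.
  - by exists 1.
  - move=> P Q [d d0 dP] [d' d'0 dQ].
    have dr : d \is Num.real by rewrite gtr0_real.
    have d'r : d' \is Num.real by rewrite gtr0_real.
    have [dd'|d'd] := real_leP dr d'r.
      exists d => // c /= cd; split; first exact: dP.
      by apply: dQ; rewrite /= (lt_le_trans cd).
    exists d' => // c /= cd; split; last exact: dQ.
    by apply: dP; rewrite /= (lt_trans cd).
  - by move=> P Q PQ [d d0 dP]; exists d => // c /dP/PQ.
have cG : cvg G.
  apply: complex_cauchy_cvg; apply/cauchy_ballP => d d0.
  (* Two scalars of D have multiples of e less than d times the norm of e apart, so they are less
     than d apart. *)
  pose D := [set c : R[i] | `|x - c *: e| < d * `|e| / 2]%classic.
  have GD : G D by exists (d * `|e| / 2) => //; rewrite !mulr_gt0.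
  exists (D, D); first by [].
  move=> [c c'] [/= Dc Dc'].
  change (`|c - c'| < d); rewrite -(ltr_pM2r ne) -normrZ scalerBl.
  have -> : c *: e - c' *: e = (x - c' *: e) - (x - c *: e).
    by rewrite opprB [RHS]addrC addrA subrK.
  by rewrite (le_lt_trans (ler_normB _ _))// (splitr (d * `|e|)) ltrD.
exists (lim G).
have h1 : (fun c : R[i]^o => c *: e) @ G --> lim G *: e.
  by apply: cvgZ; [exact: cG|exact: cvg_cst].
have h2 : (fun c : R[i]^o => c *: e) @ G --> x.
  apply/cvgrPdist_lt => d d0; by exists d.
exact: (cvg_unique _ h2 h1).
Qed.
End ClosedLine.

(** * Matrices as a C*-algebra *)

Section HermitianNorm.
Variables (C : numClosedFieldType) (n : nat).
Implicit Types (u v : 'rV[C]_n) (A B : 'M[C]_n).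

Local Notation "''[' u , v ]" := (dotmx u v) : ring_scope.
Local Notation "''[' u ]" := (dotmx u u) : ring_scope.

Definition hnorm u : C := sqrtC '[u].
Definition adjmx A : 'M[C]_n := map_mx Num.conj A^T.

Lemma hnorm_sqr u : hnorm u ^+ 2 = '[u].
Proof. exact: sqrtCK. Qed.

Lemma hnorm_ge0 u : 0 <= hnorm u.
Proof. by rewrite sqrtC_ge0 (dnorm_ge0 (@dotmx C n)). Qed.

Lemma hnorm_mul_le1 u v : hnorm u <= 1 -> hnorm v <= 1 -> hnorm u * hnorm v <= 1.
Proof. by move=> u1 v1; rewrite mulr_ile1 ?hnorm_ge0. Qed.

Lemma hnorm_eq0 u : (hnorm u == 0) = (u == 0).
Proof. by rewrite sqrtC_eq0 (dnorm_eq0 (@dotmx C n)). Qed.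

Lemma hnorm0 : hnorm 0 = 0.
Proof. by apply/eqP; rewrite hnorm_eq0. Qed.

Lemma hnorm_gt0 u : u != 0 -> 0 < hnorm u.
Proof. by move=> u0; rewrite lt_def hnorm_eq0 u0 hnorm_ge0. Qed.

Lemma hnormZ a u : hnorm (a *: u) = `|a| * hnorm u.
Proof.
rewrite /hnorm (dnormZ (@dotmx C n)).
by rewrite sqrtCM ?qualifE/= ?exprn_ge0// ?(dnorm_ge0 (@dotmx C n))// sqrCK.
Qed.

Lemma hnorm_delta (k : 'I_n) : hnorm (delta_mx 0 k) = 1.
Proof.
rewrite /hnorm dotmxE mxE (bigD1 k)//= big1 => [|l lk].
  by rewrite !mxE !eqxx/= conjC1 mulr1 addr0 sqrtC1.
by rewrite !mxE (negbTE lk) mul0r.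
Qed.

Lemma dotmx_delta A i j : '[delta_mx 0 i *m A, delta_mx 0 j] = A i j.
Proof.
rewrite -rowE dotmxE mxE (bigD1 j)//= big1 => [|l lj].
  by rewrite !mxE !eqxx/= conjC1 mulr1 addr0.
by rewrite !mxE (negbTE lj) andbF conjC0 mulr0.
Qed.

Lemma dotmxDl u v w : '[u + v, w] = '[u, w] + '[v, w].
Proof. by rewrite !dotmxE mulmxDl mxE. Qed.

Lemma dotmxZl a u v : '[a *: u, v] = a * '[u, v].
Proof. by rewrite !dotmxE -scalemxAl mxE. Qed.

Lemma dotmxZr a u v : '[u, a *: v] = a^* * '[u, v].
Proof. by rewrite !dotmxE linearZ map_mxZ -scalemxAr mxE. Qed.

Lemma dotmx_adjmx u v A : '[u *m A, v] = '[u, v *m adjmx A].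
Proof.
rewrite /adjmx !dotmxE trmx_mul map_mxM mulmxA; congr ((_ *m _ *m _) _ _).
by apply/matrixP => i j; rewrite !mxE/= conjCK.
Qed.

Lemma adjmxK A : adjmx (adjmx A) = A.
Proof. by apply/matrixP => i j; rewrite !mxE conjCK. Qed.

Lemma norm_dotmxC u v : `|'[u, v]| = `|'[v, u]|.
Proof.
rewrite -norm_conjC !dotmxE !mxE rmorph_sum; congr `|_|.
by apply: eq_bigr => i _; rewrite !mxE rmorphM/= conjCK mulrC.
Qed.

Lemma dotmx_le u v : `|'[u, v]| <= hnorm u * hnorm v.
Proof. by have [] := CauchySchwarz_sqrt (@dotmx C n) u v. Qed.

Lemma norm_entry_le u i : `|u 0 i| <= hnorm u.
Proof.
rewrite -(@ler_pXn2r _ 2)// ?nnegrE ?hnorm_ge0// hnorm_sqr dotmxE mxE (bigD1 i)//=.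
rewrite !mxE -normCK lerDl sumr_ge0// => j _.
by rewrite !mxE -normCK exprn_ge0.
Qed.

(** A crude bound through the entries. It makes the supremum defining the operator norm finite, and
    it lets entrywise convergence control that norm. *)
Lemma norm_form_le u v A :
  `|'[u *m A, v]| <= (\sum_i \sum_j `|A i j|) * (hnorm u * hnorm v).
Proof.
have -> : '[u *m A, v] = \sum_j \sum_i u 0 i * A i j * (v 0 j)^*.
  rewrite dotmxE mxE; apply: eq_bigr => j _; rewrite mxE mulr_suml.
  by apply: eq_bigr => i _; rewrite !mxE.
rewrite exchange_big/= (le_trans (ler_norm_sum _ _ _))// mulr_suml ler_sum// => i _.
rewrite (le_trans (ler_norm_sum _ _ _))// mulr_suml ler_sum// => j _.
rewrite !normrM norm_conjC mulrAC mulrC ler_wpM2l//.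
by rewrite ler_pM// norm_entry_le.
Qed.

(** By homogeneity: nonzero vectors are rescaled to length one. *)
Lemma form_bound A (L : C) : 0 <= L ->
  (forall u v, hnorm u <= 1 -> hnorm v <= 1 -> `|'[u *m A, v]| <= L) ->
  forall u v, `|'[u *m A, v]| <= L * (hnorm u * hnorm v).
Proof.
move=> L0 AL u v; have [->|u0] := eqVneq u 0.
  by rewrite dotmxE !mul0mx mxE normr0 !mulr_ge0 ?hnorm_ge0.
have [->|v0] := eqVneq v 0.
  by rewrite dotmxE trmx0 map_mx0 mulmx0 mxE normr0 !mulr_ge0 ?hnorm_ge0.
have pu := hnorm_gt0 u0; have pv := hnorm_gt0 v0.
rewrite -ler_pdivrMr ?mulr_gt0//.
have -> : `|'[u *m A, v]| / (hnorm u * hnorm v) =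
    `|'[((hnorm u)^-1 *: u) *m A, (hnorm v)^-1 *: v]|.
  rewrite -scalemxAl dotmxZl dotmxZr !normrM norm_conjC.
  by rewrite !normfV !(ger0_norm (hnorm_ge0 _)) invfM mulrC mulrA.
by apply: AL; rewrite hnormZ ger0_norm ?invr_ge0 ?hnorm_ge0// mulVf ?gt_eqF.
Qed.

Lemma form_bound1 A (L : C) u v : 0 <= L ->
  (forall u v, `|'[u *m A, v]| <= L * (hnorm u * hnorm v)) ->
  hnorm u <= 1 -> hnorm v <= 1 -> `|'[u *m A, v]| <= L.
Proof.
by move=> L0 AL u1 v1; rewrite (le_trans (AL u v))// ler_piMr// hnorm_mul_le1.
Qed.

End HermitianNorm.

Section OperatorNorm.
Variables (C : numClosedFieldType) (n : nat) (N : 'M[C]_n -> C).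
Implicit Types (u v : 'rV[C]_n) (A B : 'M[C]_n).
Local Notation "''[' u , v ]" := (dotmx u v) : ring_scope.
Local Notation "''[' u ]" := (dotmx u u) : ring_scope.
(** The three hypotheses characterise N A as the least nonnegative constant bounding the form of A.
    The C*-norm properties below use only this. *)
Hypothesis N_ge0 : forall A, 0 <= N A.
Hypothesis N_bound :
  forall u v A, `|'[u *m A, v]| <= N A * (hnorm u * hnorm v).
Hypothesis N_le : forall A (L : C), 0 <= L ->
  (forall u v, `|'[u *m A, v]| <= L * (hnorm u * hnorm v)) -> N A <= L.

Lemma opmx_norm_entry A i j : `|A i j| <= N A.
Proof.
have := N_bound (delta_mx 0 i) (delta_mx 0 j) A.
by rewrite !hnorm_delta !mulr1 dotmx_delta.
Qed.

Lemma opmx_norm_sum A : N A <= \sum_i \sum_j `|A i j|.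
Proof.
apply: N_le => [|u v]; last exact: norm_form_le.
by rewrite sumr_ge0// => i _; rewrite sumr_ge0.
Qed.

Lemma opmx_normD A B : N (A + B) <= N A + N B.
Proof.
apply: N_le => [|u v]; first by rewrite addr_ge0 ?N_ge0.
rewrite mulmxDr dotmxDl mulrDl.
by rewrite (le_trans (ler_normD _ _))// lerD// N_bound.
Qed.

(** One inequality holds for every scalar; applied to the inverse of a it gives the other. *)
Lemma opmx_normZ a A : N (a *: A) = `|a| * N A.
Proof.
have le b B : N (b *: B) <= `|b| * N B.
  apply: N_le => [|u v]; first by rewrite mulr_ge0 ?N_ge0.
  rewrite -scalemxAr dotmxZl normrM -mulrA.
  by rewrite ler_wpM2l// N_bound.
apply/eqP; rewrite eq_le le/=; have [->|a0] := eqVneq a 0.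
  by rewrite normr0 mul0r N_ge0.
have pa : 0 < `|a| by rewrite normr_gt0.
rewrite -(ler_pM2l (x := `|a|^-1)) ?invr_gt0// mulKf ?gt_eqF//.
by rewrite -{1}(scalerK a0 A) (le_trans (le _ _))// normfV.
Qed.

Lemma opmx_norm_eq0 A : N A = 0 -> A = 0.
Proof.
move=> A0; apply/matrixP => i j; rewrite mxE; apply/eqP; rewrite -normr_le0.
by rewrite -A0 opmx_norm_entry.
Qed.

Lemma opmx_norm_adj A : N (adjmx A) = N A.
Proof.
have le B : N (adjmx B) <= N B.
  apply: N_le => [|u v]; first exact: N_ge0.
  by rewrite dotmx_adjmx adjmxK norm_dotmxC [hnorm u * _]mulrC N_bound.
by apply/eqP; rewrite eq_le le/= -{1}(adjmxK A) le.
Qed.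

(** Test the form of A on u and u A, then cancel one factor [hnorm (u *m A)]. *)
Lemma hnorm_mulmx u A : hnorm (u *m A) <= N A * hnorm u.
Proof.
have [->|w0] := eqVneq (u *m A) 0.
  by rewrite hnorm0 mulr_ge0 ?N_ge0 ?hnorm_ge0.
have pw : 0 < hnorm (u *m A) by exact: hnorm_gt0.
rewrite -(ler_pM2r pw) -mulrA -expr2 hnorm_sqr.
have := N_bound u (u *m A) A.
by rewrite ger0_norm// (dnorm_ge0 (@dotmx C n)).
Qed.

Lemma opmx_normM A B : N (A *m B) <= N A * N B.
Proof.
apply: N_le => [|u v]; first by rewrite mulr_ge0 ?N_ge0.
rewrite mulmxA dotmx_adjmx (le_trans (dotmx_le _ _))//.
rewrite mulrACA ler_pM ?hnorm_ge0 ?hnorm_mulmx//.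
by rewrite -(opmx_norm_adj B) hnorm_mulmx.
Qed.

(** For the nontrivial inequality, the squared length of [u *m adjmx A] is the form of
    [adjmx A *m A] at u. So [sqrtC M] bounds the adjoint on vectors, hence its form by
    Cauchy-Schwarz, and A has the norm of its adjoint. *)
Lemma opmx_cstar A : N (adjmx A *m A) = N A ^+ 2.
Proof.
apply/eqP; rewrite eq_le; apply/andP; split.
  by rewrite (le_trans (opmx_normM _ _))// opmx_norm_adj expr2.
set M := N (adjmx A *m A).
have M0 : 0 <= M by exact: N_ge0.
have hM u : hnorm (u *m adjmx A) <= sqrtC M * hnorm u.
  rewrite -(@ler_pXn2r _ 2)// ?nnegrE ?hnorm_ge0//; last first.
    by rewrite mulr_ge0 ?hnorm_ge0// sqrtC_ge0.
  rewrite exprMn !hnorm_sqr sqrtCK.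
  have -> : '[u *m adjmx A] = `|'[u *m (adjmx A *m A), u]|.
    by rewrite mulmxA [in RHS]dotmx_adjmx ger0_norm// (dnorm_ge0 (@dotmx C n)).
  by rewrite (le_trans (N_bound _ _ _))// -expr2 hnorm_sqr lexx.
rewrite -(opmx_norm_adj A) -(sqrtCK M) ler_pXn2r ?nnegrE ?N_ge0 ?sqrtC_ge0//.
apply: N_le => [|u v]; first by rewrite sqrtC_ge0.
by rewrite (le_trans (dotmx_le _ _))// mulrA ler_pM ?hnorm_ge0.
Qed.

End OperatorNorm.

Section MatrixCStarAlgebra.
Local Open Scope classical_set_scope.
Variables (R : realType) (n : nat).
Implicit Types (u v : 'rV[R[i]]_n) (A B : 'M[R[i]]_n).

Local Notation "''[' u , v ]" := (dotmx u v) : ring_scope.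
Local Notation "''[' u ]" := (dotmx u u) : ring_scope.

(** Norms take values in [R[i]]; the real part is taken so that the supremum is formed in [R]. *)
Definition opmx_set A : set R :=
  [set complex.Re `|'[u.1 *m A, u.2]| |
    u in [set u : 'rV[R[i]]_n * 'rV[R[i]]_n | hnorm u.1 <= 1 /\ hnorm u.2 <= 1]].

Definition opmx_norm A : R[i] := (sup (opmx_set A))%:C%C.

Lemma opmx_set_has_sup A : has_sup (opmx_set A).
Proof.
split.
  by exists (complex.Re `|'[0 *m A, 0]|), (0, 0) => //=; rewrite hnorm0.
exists (complex.Re (\sum_i \sum_j `|A i j|)) => _ [[u v] /= [u1 v1] <-].
rewrite -lecR !RRe_real ?normr_real ?sum_real//; last first.
  by move=> i _; rewrite sum_real// => j _; rewrite normr_real.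
rewrite (le_trans (norm_form_le u v A))// ler_piMr ?sumr_ge0//.
  by move=> i _; rewrite sumr_ge0.
exact: hnorm_mul_le1.
Qed.

Lemma opmx_norm_ge0 A : 0 <= opmx_norm A.
Proof.
rewrite ler0c; apply: ub_le_sup; first by have [] := opmx_set_has_sup A.
exists (0, 0) => /=; first by rewrite hnorm0 ler01.
by rewrite dotmxE !mul0mx mxE Normc.normc0.
Qed.

Lemma opmx_norm_bound u v A : `|'[u *m A, v]| <= opmx_norm A * (hnorm u * hnorm v).
Proof.
move: u v; apply: form_bound => [|u v u1 v1]; first exact: opmx_norm_ge0.
rewrite -(RRe_real (normr_real _)) lecR; apply: ub_le_sup.
  by have [] := opmx_set_has_sup A.
exact: (ex_intro2 _ _ (u, v) (conj u1 v1) erefl).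
Qed.

Lemma opmx_norm_le A (L : R[i]) : 0 <= L ->
  (forall u v, `|'[u *m A, v]| <= L * (hnorm u * hnorm v)) -> opmx_norm A <= L.
Proof.
move=> L0 AL; rewrite -(RRe_real (ger0_real L0)) lecR; apply: ge_sup.
  by have [] := opmx_set_has_sup A.
move=> _ [[u v] [u1 v1] <-].
rewrite -lecR (RRe_real (normr_real _)) (RRe_real (ger0_real L0)).
exact: form_bound1 L0 AL u1 v1.
Qed.

Definition opmx : Type := 'M[R[i]]_n.

HB.instance Definition _ := GRing.Lmodule.copy opmx 'M[R[i]]_n.

Let opmx_normD' := opmx_normD opmx_norm_ge0 opmx_norm_bound opmx_norm_le.
Let opmx_normZ' := opmx_normZ opmx_norm_ge0 opmx_norm_bound opmx_norm_le.
Let opmx_norm_eq0' := opmx_norm_eq0 opmx_norm_bound.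

HB.instance Definition _ := Lmodule_isNormed.Build R[i] opmx
  opmx_normD' opmx_normZ' opmx_norm_eq0'.

Lemma opmx_normE (A : opmx) : `|A| = opmx_norm A.
Proof. by []. Qed.

(** Each entry is dominated by the norm, so the entries converge; the norm is dominated by the sum
    of the entries, so the entrywise limit is a limit in norm. *)
Lemma opmx_cauchy_cvg (F : set_system opmx) :
  ProperFilter F -> cauchy F -> cvg F.
Proof.
move=> FF /cauchy_ballP cF.
have cvE i j : cvg ((fun A : opmx => A i j : R[i]^o) @ F).
  apply: complex_cauchy_cvg; apply/cauchy_ballP => e e0.
  rewrite near_map2; apply: filterS (cF _ e0) => -[x y]; rewrite /ball/= => xye.
  have := opmx_norm_entry opmx_norm_bound (x - y) i j.
  rewrite !mxE => /le_lt_trans; exact.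
pose M : opmx := \matrix_(i, j) lim ((fun A : opmx => A i j : R[i]^o) @ F).
apply/cvg_ex; exists M; apply/cvgrPdist_lt => e e0.
(* The n * n entries contribute at most n * n * d; the successor keeps this strictly below e and the
   denominator nonzero. *)
pose d := e / (n * n).+1%:R.
have d0 : 0 < d by rewrite divr_gt0.
have nd i j : \forall A \near F, `|M i j - (A : opmx) i j| < d.
  by rewrite mxE; move/cvgrPdist_lt : (cvE i j) => /(_ _ d0).
have : \forall A \near F, forall ij : 'I_n * 'I_n,
    `|M ij.1 ij.2 - (A : opmx) ij.1 ij.2| < d.
  by apply: filter_forall => -[i j]; exact: nd.
apply: filterS => A MA; rewrite opmx_normE.
have := opmx_norm_sum opmx_norm_le ((M : 'M[R[i]]_n) - A).
move=> /le_lt_trans; apply.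
rewrite pair_big/= (le_lt_trans (y := \sum_(ij : 'I_n * 'I_n) d))//.
  by apply: ler_sum => -[i j] _; rewrite ltW// !mxE; have := MA (i, j); rewrite !mxE.
rewrite sumr_const card_prod card_ord -mulr_natr /d -mulrA gtr_pMr//.
by rewrite mulrC ltr_pdivrMr// mul1r ltr_nat.
Qed.

HB.instance Definition _ := Uniform_isComplete.Build opmx opmx_cauchy_cvg.

Definition opmx_mul (A B : opmx) : opmx := (A : 'M[R[i]]_n) *m B.
Definition opmx_star (A : opmx) : opmx := adjmx (A : 'M[R[i]]_n).

Lemma opmx_starK : involutive opmx_star.
Proof. exact: adjmxK. Qed.

Lemma opmx_starD : {morph opmx_star : x y / x + y}.
Proof. by move=> x y; rewrite /opmx_star/adjmx linearD map_mxD. Qed.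

Lemma opmx_starM x y : opmx_star (opmx_mul x y) = opmx_mul (opmx_star y) (opmx_star x).
Proof. by rewrite /opmx_star/adjmx /opmx_mul trmx_mul map_mxM. Qed.

Lemma opmx_starZ (a : R[i]) x : opmx_star (a *: x) = a^* *: opmx_star x.
Proof. by rewrite /opmx_star/adjmx linearZ map_mxZ. Qed.

HB.instance Definition _ := Lmodule_isStarAlgebra.Build R[i] opmx
  (@mulmxA _ _ _ _ _ : associative opmx_mul) (@mulmxDl _ _ _ _) (@mulmxDr _ _ _ _)
  (fun a x y => esym (scalemxAl a x y)) (fun a x y => esym (scalemxAr a x y))
  opmx_starK opmx_starD opmx_starM opmx_starZ.

Lemma opmx_ler_normaM (x y : opmx) : `|x ** y| <= `|x| * `|y|.
Proof. exact: (opmx_normM opmx_norm_ge0 opmx_norm_bound opmx_norm_le). Qed.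

Lemma opmx_cstar_identity (x : opmx) : `|star x ** x| = `|x| ^+ 2.
Proof. exact: (opmx_cstar opmx_norm_ge0 opmx_norm_bound opmx_norm_le). Qed.

HB.instance Definition _ := StarAlgebra_isCStar.Build R[i] opmx
  opmx_ler_normaM opmx_cstar_identity.

End MatrixCStarAlgebra.

(** * Paths into sinks *)

Section Walks.
Variable E : digraph.
Implicit Types (v w : vertex E) (p : seq (edge E)).

Definition walk_end v p : vertex E := last v (map (@rng E) p).

Lemma is_walk_end v p w : is_walk v p w -> walk_end v p = w.
Proof.
by elim: p v => [v /eqP|e p IH v /= /andP[_]]; [|exact: IH].
Qed.

Lemma is_walk_prefix v p w x : is_walk v p w -> x \in map (@rng E) p ->
  exists2 q, is_walk v q x & q != [::].
Proof.
elim: p v => [|e p IH] v //= /andP[ev pw]; rewrite inE => /predU1P[->|xp].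
  by exists [:: e] => //=; rewrite ev eqxx.
by have [q qx _] := IH _ pw xp; exists (e :: q) => //=; rewrite ev.
Qed.

Hypothesis acyclicE : acyclic E.

(** A walk visits no vertex twice, since a return would give a nonempty closed walk. *)
Lemma acyclic_size v p w : is_walk v p w -> (size p < #|vertex E|)%N.
Proof.
suff up : forall v p w, is_walk v p w -> uniq (v :: map (@rng E) p).
  move=> /up /card_uniqP /= s; rewrite size_map in s.
  by rewrite -s max_card.
move=> {v p w} v p w; elim: p v => [//|e p IH] v pw.
have /andP[_ /IH up] := pw.
apply/andP; split; last exact: up.
apply/negP => /(is_walk_prefix pw)[q qv /negP]; apply.
by rewrite (acyclicE qv).
Qed.

(* The walks of an acyclic graph ending in a sink; the bound on the length
   only serves to make their type finite. *)
Definition sink_path_pred (q : vertex E * {bseq #|vertex E| of edge E}) : bool :=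
  is_walk q.1 q.2 (walk_end q.1 q.2) && is_sink (walk_end q.1 q.2).

Definition sink_path : predArgType := {q | sink_path_pred q}.

HB.instance Definition _ := Finite.on sink_path.

Implicit Types a b : sink_path.

Definition start a : vertex E := (val a).1.
Definition steps a : seq (edge E) := (val a).2.
Definition target a : vertex E := walk_end (start a) (steps a).

Lemma sink_path_walk a : is_walk (start a) (steps a) (target a).
Proof. by have /andP[] := valP a. Qed.

Lemma target_sink a : is_sink (target a).
Proof. by have /andP[] := valP a. Qed.

Lemma sink_path_eq a b : start a = start b -> steps a = steps b -> a = b.
Proof.
case: a b => -[v p] vp [[w q] wq]; rewrite /start /steps /= => vw pq.
by apply/val_inj => /=; rewrite vw; congr pair; exact: val_inj.
Qed.

Lemma sink_path_ex v p w : is_walk v p w -> is_sink w ->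
  exists a, [/\ start a = v, steps a = p & target a = w].
Proof.
move=> pw sw; have sp : (size p <= #|vertex E|)%N by rewrite ltnW// (acyclic_size pw).
have H : sink_path_pred (v, Bseq sp) by rewrite /sink_path_pred /= (is_walk_end pw) pw.
by exists (exist sink_path_pred _ H); split => //; exact: is_walk_end pw.
Qed.

Lemma sink_path_nil v : is_sink v -> exists a, [/\ start a = v, steps a = [::] & target a = v].
Proof. by move=> sv; apply: sink_path_ex => //=. Qed.

Lemma sink_path_cons e b : start b = rng e ->
  exists a, [/\ start a = src e, steps a = e :: steps b & target a = target b].
Proof.
move=> be; apply: sink_path_ex; last exact: target_sink.
by rewrite /= eqxx -be sink_path_walk.
Qed.

Lemma sink_path_tail a e p : steps a = e :: p ->
  exists b, [/\ start b = rng e, steps b = p & target b = target a].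
Proof.
move=> ap; apply: sink_path_ex; last exact: target_sink.
by have := sink_path_walk a; rewrite ap => /andP[].
Qed.

Lemma start_cons a e p : steps a = e :: p -> start a = src e.
Proof. by have := sink_path_walk a => + ap; rewrite ap => /andP[/eqP->]. Qed.

Lemma steps_nil a : steps a = [::] -> start a = target a.
Proof. by move=> a0; rewrite /target a0. Qed.

Lemma steps_sink a : is_sink (start a) -> steps a = [::].
Proof.
case ap : (steps a) => [//|e p] /forallP/(_ e)/negP[].
by rewrite (start_cons ap).
Qed.

(* Prepending e is a bijection from the sink paths starting at the range of e
   onto those whose first edge is e. *)
Lemma big_sink_path_cons (M : nmodType) (e : edge E) (F : sink_path -> M)
    (G : sink_path -> M) :
  (forall a b, start b = rng e -> steps a = e :: steps b -> F a = G b) ->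
  \sum_(a | ohead (steps a) == Some e) F a = \sum_(b | start b == rng e) G b.
Proof.
move=> FG.
(* Prepending e and removing the first edge are made total by arbitrary values off their domains;
   the reindexing only sees the domains. *)
have consP b : exists a, start b = rng e -> steps a = e :: steps b.
  case: (eqVneq (start b) (rng e)) => [be|/eqP bne]; last by exists b.
  by have [a []] := sink_path_cons be; exists a.
have [c cP] := boolp.choice consP.
have tailP a : exists b, forall p, steps a = e :: p -> start b = rng e /\ steps b = p.
  case ap : (steps a) => [|f p]; first by exists a.
  case: (eqVneq f e) => [fe|fne].
    have [b [b1 b2 _]] := sink_path_tail ap; exists b => q [_ <-].
    by rewrite b1 fe.
  by exists a => q [fe]; rewrite fe eqxx in fne.
have [t tP] := boolp.choice tailP.
rewrite (reindex_onto c t) => [|a]; last first.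
  case ap : (steps a) => [//|f p] /eqP[fe]; rewrite fe in ap.
  have [t1 t2] := tP _ _ ap; apply: sink_path_eq.
    by rewrite (start_cons ap) (start_cons (cP _ t1)).
  by rewrite (cP _ t1) t2 ap.
have sb b : (ohead (steps (c b)) == Some e) && (t (c b) == b) = (start b == rng e).
  apply/andP/eqP => [[]|be]; last first.
    rewrite (cP _ be)/= eqxx; split=> //; have [t1 t2] := tP _ _ (cP _ be).
    by apply/eqP/sink_path_eq; rewrite ?t1 ?be ?t2.
  case cb : (steps (c b)) => [//|f p] /eqP[fe] /eqP tb.
  by rewrite fe in cb; have [+ _] := tP _ _ cb; rewrite tb.
by apply: eq_big => [//|b]; rewrite sb => /eqP be; exact: FG (cP _ be).
Qed.

Definition plen a : nat := size (steps a).

(** Translates the counts of the statement into cardinals over the finite type [sink_path], which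
    contains every walk into a sink exactly once. *)
Lemma num_pathsE k v i : is_sink v ->
  num_paths_to k v i = #|[pred a | (target a == v) && (plen a == i %[mod k])]|.
Proof.
move=> sv; pose f a : vertex E * seq (edge E) := (start a, steps a).
have fI : injective f by move=> a b [/sink_path_eq]; exact.
set P := [pred a | _]; rewrite /num_paths_to.
have -> : paths_to k v i = (f @` [set` P])%classic.
  apply/seteqP; split=> [[w p] /= [wp pk]|_ [a /andP[/eqP av /eqP ak] <-]].
    have [a [aw ap av]] := sink_path_ex wp sv.
    by exists a; rewrite /f ?aw ?ap//= inE av eqxx/= /plen ap; apply/eqP.
  by split=> //=; rewrite -av sink_path_walk.
rewrite fset_set_image// card_imfset//= cardE; apply/perm_size/uniq_perm.
- exact: fset_uniq.
- exact: enum_uniq.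
- by move=> a; rewrite in_fset_set// mem_enum mem_setE.
Qed.

End Walks.

(** * Cuntz-Krieger families *)

Section StarAlgebraFacts.
Variables (C : numClosedFieldType) (A : starAlgType C).
Implicit Types x y z : A.

Lemma amul0r x : x ** 0 = 0.
Proof. by apply: (addrI (x ** 0)); rewrite -amulDr !addr0. Qed.

Lemma amul0l x : 0 ** x = 0.
Proof. by apply: (addrI (0 ** x)); rewrite -amulDl !addr0. Qed.

Lemma amulNr x y : x ** - y = - (x ** y).
Proof. by rewrite -scaleN1r amulZr scaleN1r. Qed.

Lemma amulNl x y : - x ** y = - (x ** y).
Proof. by rewrite -scaleN1r amulZl scaleN1r. Qed.

(** Doubling the middle idempotent turns one summand of a corner of a product into a product of two
    corners. *)
Lemma amul_idem_split x y z w p : p ** p = p ->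
  x ** (y ** p ** z) ** w = (x ** y ** p) ** (p ** z ** w).
Proof. by move=> pp; rewrite !amulA -(amulA (x ** y) p p) pp. Qed.

Lemma star0 : star 0 = 0 :> A.
Proof. by apply: (addrI (star 0)); rewrite -starD !addr0. Qed.

Lemma amul_sumr x (I : Type) (r : seq I) (Q : pred I) (F : I -> A) :
  x ** (\sum_(i <- r | Q i) F i) = \sum_(i <- r | Q i) (x ** F i).
Proof. exact: (big_morph (amul x) (amulDr x) (amul0r x)). Qed.

Lemma amul_suml x (I : Type) (r : seq I) (Q : pred I) (F : I -> A) :
  (\sum_(i <- r | Q i) F i) ** x = \sum_(i <- r | Q i) (F i ** x).
Proof.
exact: (big_morph (fun y => y ** x) (fun y z => amulDl y z x) (amul0l x)).
Qed.

Lemma star_sum (I : Type) (r : seq I) (Q : pred I) (F : I -> A) :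
  star (\sum_(i <- r | Q i) F i) = \sum_(i <- r | Q i) star (F i).
Proof. exact: (big_morph _ (@starD _ A) star0). Qed.

End StarAlgebraFacts.

Lemma star_hom0 (C : numClosedFieldType) (A B : starAlgType C) (f : A -> B) :
  is_star_hom f -> f 0 = 0.
Proof. by case=> fD _ _ _; apply: (addrI (f 0)); rewrite -fD !addr0. Qed.

Lemma star_hom_sum (C : numClosedFieldType) (A B : starAlgType C) (f : A -> B)
    (I : Type) (r : seq I) (Q : pred I) (F : I -> A) : is_star_hom f ->
  f (\sum_(i <- r | Q i) F i) = \sum_(i <- r | Q i) f (F i).
Proof. by move=> fh; have [fD _ _ _] := fh; exact: (big_morph _ fD (star_hom0 fh)). Qed.

Section CStarFacts.
Local Open Scope classical_set_scope.
Variables (C : numClosedFieldType) (A : cstarAlgType C).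

Lemma lipschitz_continuous (f : A -> A) (M : C) : 0 <= M ->
  (forall x y, `|f x - f y| <= M * `|x - y|) -> continuous f.
Proof.
move=> M0 fM x; apply/cvgrPdist_lt => e e0.
have M1 : 0 < M + 1 by rewrite ltr_wpDl.
have d0 : 0 < e / (M + 1) by rewrite divr_gt0.
apply: filterS (nbhsx_ballx x _ d0) => y; rewrite -ball_normE /= => xy.
rewrite (le_lt_trans (fM _ _))//; rewrite ltr_pdivlMr// mulrC in xy.
by apply: le_lt_trans xy; rewrite ler_wpM2r// lerDl.
Qed.

Lemma amul_continuous (p q : A) : continuous (fun x : A => p ** x ** q).
Proof.
apply: (@lipschitz_continuous _ (`|p| * `|q|)) => [|x y]; first by rewrite mulr_ge0.
have -> : p ** x ** q - p ** y ** q = p ** (x - y) ** q.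
  by rewrite amulDr amulDl amulNr amulNl.
rewrite (le_trans (ler_normaM _ _))// mulrAC ler_wpM2r//.
by rewrite ler_normaM.
Qed.

End CStarFacts.

Section CuntzKrieger.
Variables (R : realType) (E : digraph) (A : cstarAlgType R[i]).
Variables (P : vertex E -> A) (S : edge E -> A).
Hypothesis CK : is_CK_family P S.

Lemma star_P v : star (P v) = P v.
Proof. by have [[pP _] _ _ _ _] := CK; have [] := pP v. Qed.

Lemma mul_P v w : P v ** P w = if v == w then P v else 0.
Proof.
have [[pP oP] _ _ _ _] := CK; case: eqVneq => [->|/oP//].
by have [] := pP w.
Qed.

Lemma starS_S e : star (S e) ** S e = P (rng e).
Proof. by have [_ _ SS _ _] := CK. Qed.

Lemma S_P e : S e ** P (rng e) = S e.
Proof. by rewrite -starS_S amulA; have [_ [pS _] _ _ _] := CK; exact: pS. Qed.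

Lemma P_starS e : P (rng e) ** star (S e) = star (S e).
Proof. by rewrite -{1}star_P -starM S_P. Qed.

(** Both factors absorb their range projections, and these are orthogonal. *)
Lemma starS_S_neq e f : e != f -> star (S e) ** S f = 0.
Proof.
move=> ef; rewrite -P_starS -starS_S -(S_P f) -starS_S.
have [_ [_ oS] _ _ _] := CK.
by rewrite -!amulA (amulA (S e)) (amulA (S f)) (amulA (_ ** _) (_ ** _)) oS// amul0l amul0r.
Qed.

Lemma P_src e : P (src e) = \sum_(f | src f == src e) S f ** star (S f).
Proof. by have [_ _ _ _] := CK; apply; exists e. Qed.

Lemma P_S e : P (src e) ** S e = S e.
Proof.
rewrite P_src amul_suml (bigD1 e)//= big1 ?addr0 => [|f /andP[_ fe]].
  by rewrite -amulA starS_S S_P.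
by rewrite -amulA starS_S_neq ?amul0r.
Qed.

Lemma P_S_if v e : P v ** S e = if v == src e then S e else 0.
Proof.
rewrite -{1}(P_S e) amulA mul_P; case: eqVneq => [->|_]; first exact: P_S.
by rewrite amul0l.
Qed.

(** The trailing vertex projection makes the empty walk give [P v]. *)
Definition walk_elt v (p : seq (edge E)) : A :=
  foldr (fun e x => S e ** x) (P (walk_end v p)) p.

Lemma P_walk v w p : is_walk w p (walk_end w p) ->
  P v ** walk_elt w p = if v == w then walk_elt w p else 0.
Proof.
rewrite /walk_elt; case: p => [|e p] /=.
  by move=> _; rewrite mul_P; case: eqVneq => [->|].
by move=> /andP[/eqP <- _]; rewrite amulA P_S_if; case: eqP; rewrite ?amul0l.
Qed.

Lemma walk_P v p w : walk_elt v p ** P w = if walk_end v p == w then walk_elt v p else 0.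
Proof.
rewrite /walk_elt; move: (walk_end v p) => x.
elim: p => [|e p IH] /=; first by rewrite mul_P.
by rewrite -amulA IH; case: eqP; rewrite ?amul0r.
Qed.

(** Equal first edges cancel and distinct ones annihilate. If one walk is exhausted first, it is at
    a sink, where the other cannot continue; so a proper prefix also gives 0. *)
Lemma star_walk_walk v p w q : is_walk v p (walk_end v p) -> is_sink (walk_end v p) ->
  is_walk w q (walk_end w q) -> is_sink (walk_end w q) ->
  star (walk_elt v p) ** walk_elt w q =
  if (v == w) && (p == q) then P (walk_end v p) else 0.
Proof.
have nil x y r : is_sink x -> is_walk y r (walk_end y r) ->
    P x ** walk_elt y r = if (x == y) && ([::] == r) then P x else 0.
  move=> sx yr; rewrite P_walk//; case: eqVneq => //= xy.
  case: r yr => [|e r] /=; first by rewrite /walk_elt /= xy.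
  by move=> /andP[/eqP ey _]; have /forallP/(_ e) := sx; rewrite ey xy eqxx.
elim: p v w q => [|e p IH] v w [|f q] vp sv wq sw.
- by rewrite {1}/walk_elt /= star_P nil.
- by rewrite {1}/walk_elt /= star_P nil.
- have -> : star (walk_elt v (e :: p)) ** walk_elt w [::] =
      star (P w ** walk_elt v (e :: p)) by rewrite starM star_P.
  by rewrite nil// andbF star0 andbF.
have /andP[/eqP ev p'] := vp; have /andP[/eqP fw q'] := wq.
rewrite {1}/walk_elt /= -/(walk_elt (rng e) p) -/(walk_elt (rng f) q).
rewrite /walk_elt /= -/(walk_elt (rng e) p) -/(walk_elt (rng f) q).
rewrite starM -amulA (amulA (star (S e))) eqseq_cons.
have [ef|ef] := eqVneq e f; last first.
  by rewrite starS_S_neq// amul0l amul0r andbF.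
subst f; rewrite starS_S -ev -fw !eqxx /= P_walk// eqxx IH// eqxx.
by [].
Qed.

End CuntzKrieger.

(** * Matrix units *)

Section MatrixUnits.
Variables (R : realType) (E : digraph) (A : cstarAlgType R[i]).
Variables (P : vertex E -> A) (S : edge E -> A).
Hypothesis acyclicE : acyclic E.
Hypothesis CK : is_CK_family P S.
Implicit Types a b c d : sink_path E.

Definition path_elt a : A := walk_elt P S (start a) (steps a).
Definition munit a b : A := path_elt a ** star (path_elt b).

Lemma P_path_elt v a : P v ** path_elt a = if v == start a then path_elt a else 0.
Proof. by rewrite (P_walk CK)// sink_path_walk. Qed.

Lemma path_elt_P a v : path_elt a ** P v = if target a == v then path_elt a else 0.
Proof. by rewrite (walk_P CK). Qed.

Lemma path_elt_cons e a b : start b = rng e -> steps a = e :: steps b ->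
  path_elt a = S e ** path_elt b.
Proof.
move=> be ab; rewrite /path_elt ab be /walk_elt /=.
by congr (_ ** foldr _ _ _).
Qed.

Lemma star_path_elt a b :
  star (path_elt a) ** path_elt b = if a == b then P (target a) else 0.
Proof.
by rewrite (star_walk_walk CK) ?sink_path_walk ?target_sink.
Qed.

Lemma munit_mul a b c d : target a = target b ->
  munit a b ** munit c d = if b == c then munit a d else 0.
Proof.
move=> ab; rewrite /munit amulA -(amulA (path_elt a)) star_path_elt.
case: eqP => _; last by rewrite amul0r amul0l.
by rewrite path_elt_P ab eqxx.
Qed.

(** The two path elements end in orthogonal projections. Units may thus be indexed by all pairs of
    paths. *)
Lemma munit_neq a b : target a != target b -> munit a b = 0.
Proof.
move=> ab; rewrite /munit -[path_elt b](_ : path_elt b ** P (target b) = _).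
  by rewrite starM (star_P CK) amulA path_elt_P (negbTE ab) amul0l.
by rewrite path_elt_P eqxx.
Qed.

Lemma star_munit a b : star (munit a b) = munit b a.
Proof. by rewrite /munit starM starK. Qed.

(** Compressing the unit by the path elements of a and b recovers the projection at their target. *)
Lemma munit_neq0 a b : P (target a) != 0 -> target a = target b -> munit a b != 0.
Proof.
move=> Pa0 ab; apply: contra Pa0 => /eqP ab0.
have : star (path_elt a) ** munit a b ** path_elt b = 0.
  by rewrite ab0 amul0r amul0l.
rewrite /munit amulA -amulA !star_path_elt !eqxx -ab (mul_P CK) eqxx.
by move=> ->.
Qed.

(** Apply the Cuntz-Krieger relation repeatedly until every path has reached a sink. The induction
    is on a bound for the lengths of walks leaving v, which acyclicity provides. *)
Lemma P_sum_munit v : P v = \sum_(a | start a == v) munit a a.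
Proof.
suff gen m : forall v, (forall p w, is_walk v p w -> (size p <= m)%N) ->
    P v = \sum_(a | start a == v) munit a a.
  by apply: (gen #|vertex E|) => p w /(acyclic_size acyclicE)/ltnW.
have sinkP w : is_sink w -> P w = \sum_(a | start a == w) munit a a.
  move=> sw; have [a [aw a0 at_]] := sink_path_nil acyclicE sw.
  rewrite (big_pred1 a) => [|b].
    by rewrite /munit /path_elt a0 aw /walk_elt /= (star_P CK) (mul_P CK) eqxx.
  apply/eqP/eqP => [bw|->//]; apply: sink_path_eq; rewrite ?aw//.
  by rewrite a0 steps_sink// bw.
elim: m => [|m IH] {}v vm.
  apply: sinkP; apply/forallP => e; apply/negP => /eqP ev.
  by have := vm [:: e] (rng e); rewrite /= ev !eqxx => /(_ isT).
have [/sinkP//|/forallPn[e0 /negPn/eqP e0v]] := boolP (is_sink v).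
have -> : P v = \sum_(e | src e == v) S e ** star (S e).
  by rewrite -e0v (P_src CK).
have -> : \sum_(a | start a == v) munit a a =
    \sum_(e | src e == v) \sum_(a | ohead (steps a) == Some e) munit a a.
  rewrite (partition_big (fun a => odflt e0 (ohead (steps a))) (fun e => src e == v)) /=.
    apply: eq_bigr => e /eqP ev; apply: eq_bigl => a.
    case s : (steps a) => [|f p] /=.
      rewrite (steps_nil s); apply/negbTE/negP => /andP[/eqP av _].
      by have /forallP/(_ e0) := target_sink a; rewrite av e0v eqxx.
    apply/andP/eqP => [[_ /eqP -> //]|[fe]].
    by rewrite (start_cons s) fe ev.
  move=> a /eqP av; case s : (steps a) => [|f p] /=; first by rewrite e0v.
  by rewrite -(start_cons s) av.
apply: eq_bigr => e /eqP ev.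
rewrite (big_sink_path_cons acyclicE (G := fun b => S e ** munit b b ** star (S e))).
  rewrite -amul_suml -amul_sumr -IH ?(S_P CK)// => p w pw.
  by have := vm (e :: p) w; rewrite /= ev eqxx pw; apply.
by move=> a b be ab; rewrite /munit (path_elt_cons be ab) starM !amulA.
Qed.

End MatrixUnits.

Section Generated.
Local Open Scope classical_set_scope.
Variables (R : realType) (E : digraph) (A : cstarAlgType R[i]).
Variables (P : vertex E -> A) (S : edge E -> A).
Hypothesis acyclicE : acyclic E.
Hypothesis CK : is_CK_family P S.
Hypothesis genA :
  cstar_generated_by ([set P v | v in setT] `|` [set S e | e in setT]).
Implicit Types a b c d : sink_path E.

Local Notation munit := (munit P S).
Local Notation path_elt := (path_elt P S).

Lemma closed_preimage_line (p q e : A) :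
  closed [set x | exists c : R[i], p ** x ** q = c *: e].
Proof.
exact: (closed_comp (fun x _ => @amul_continuous _ _ p q x) (@closed_line _ _ e)).
Qed.

Lemma generated_ind (D : A -> Prop) :
  closed [set x | D x] -> D 0 ->
  (forall x y, D x -> D y -> D (x + y)) -> (forall x y, D x -> D y -> D (x ** y)) ->
  (forall (a : R[i]) x, D x -> D (a *: x)) -> (forall x, D x -> D (star x)) ->
  (forall v, D (P v)) -> (forall e, D (S e)) -> forall x, D x.
Proof.
move=> cD D0 DD DM DZ Dstar DP DS x.
have : [set x | D x] = setT.
  apply: genA; first split=> //.
  - by move=> y z Dy Dz; split; [exact: DD|exact: DM].
  - by move=> a y Dy; split; [exact: DZ|exact: Dstar].
  by move=> _ [[v _ <-]|[e _ <-]]; [exact: DP|exact: DS].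
by move/seteqP => [_ /(_ x I)].
Qed.

(** The elements on which this sum acts as an identity from both sides form a C*-subalgebra
    containing the generators. *)
Lemma sum_P_unit : is_unit (\sum_v P v).
Proof.
set u := \sum_v P v.
have uP v : u ** P v = P v /\ P v ** u = P v.
  rewrite amul_suml amul_sumr (bigD1 v)//= big1 => [|w wv]; last first.
    by rewrite (mul_P CK) (negbTE wv).
  rewrite (bigD1 v)//= big1 => [|w wv]; last first.
    by rewrite (mul_P CK) eq_sym (negbTE wv).
  by rewrite !addr0 (mul_P CK) eqxx.
have su : star u = u.
  by rewrite star_sum; apply: eq_bigr => v _; rewrite (star_P CK).
(* The conditions are zero sets of the additive maps u y - y and y u - y, which are Lipschitz with
   constant [|u| + 1], hence closed. *)
have lip (f : A -> A) : (forall y z, f y - f z = f (y - z)) ->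
    (forall y, `|f y| <= (`|u| + 1) * `|y|) -> closed [set y | f y = 0].
  move=> fB fle; apply: (@closed_comp _ _ f [set 0]).
    move=> y _; apply: (@lipschitz_continuous _ _ f (`|u| + 1)) => [|z w].
      by rewrite addr_ge0.
    by rewrite fB.
  exact/accessible_closed_set1/hausdorff_accessible/norm_hausdorff.
have cl : closed [set x | u ** x = x /\ x ** u = x].
  rewrite (_ : mkset _ = [set y | u ** y - y = 0] `&` [set y | y ** u - y = 0]).
    apply: closedI; apply: lip => [y z|y].
    - by rewrite amulDr amulNr !opprD addrACA.
    - by rewrite (le_trans (ler_normB _ _))// mulrDl mul1r lerD2r ler_normaM.
    - by rewrite amulDl amulNl !opprD addrACA.
    - by rewrite (le_trans (ler_normB _ _))// mulrDl mul1r lerD2r mulrC ler_normaM.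
  apply/seteqP; split=> [y [y1 y2]|y [y1 y2]] /=; first by rewrite y1 y2 subrr.
  by split; apply/subr0_eq.
move=> x; apply: (generated_ind (D := fun x => u ** x = x /\ x ** u = x)) => //.
- by rewrite amul0r amul0l.
- by move=> y z [y1 y2] [z1 z2]; rewrite amulDr amulDl y1 y2 z1 z2.
- by move=> y z [y1 y2] [z1 z2]; rewrite amulA y1 -amulA z2.
- by move=> a y [y1 y2]; rewrite amulZr amulZl y1 y2.
- move=> y [y1 y2]; split.
    by rewrite -[X in X ** _]su -starM y2.
  by rewrite -[X in _ ** X]su -starM y1.
- move=> e; split; first by rewrite -{1}(P_S CK) amulA (uP _).1 (P_S CK).
  by rewrite -{1}(S_P CK) -amulA (uP _).2 (S_P CK).
Qed.

Lemma sum_munit_unit : is_unit (\sum_a munit a a).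
Proof.
have -> : \sum_a munit a a = \sum_v P v; last exact: sum_P_unit.
rewrite (partition_big (@start E) xpredT)//=; apply: eq_bigr => v _.
by rewrite -(P_sum_munit acyclicE CK).
Qed.

Lemma mul_munit_expand x y : x ** y = \sum_a x ** munit a a ** y.
Proof.
by rewrite -amul_suml -amul_sumr (sum_munit_unit x).2.
Qed.

(** Having all corners on these lines is a property that holds for the generators and is preserved
    by the algebra operations, and by limits because lines are closed. Hence it holds on all of
    A. *)
Lemma corner_line x a b : exists c : R[i], munit a a ** x ** munit b b = c *: munit a b.
Proof.
pose D x := forall a b, exists c : R[i], munit a a ** x ** munit b b = c *: munit a b.
have D0 : D 0 by move=> {}a {}b; exists 0; rewrite amul0r amul0l scale0r.
have DD y z : D y -> D z -> D (y + z).
  move=> Dy Dz {}a {}b; have [[c cy] [d dz]] := (Dy a b, Dz a b).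
  by exists (c + d); rewrite amulDr amulDl cy dz scalerDl.
have Dunit p q : D (munit p q).
  move=> {}a {}b; rewrite munit_mul//; case: eqP => [_|_]; last first.
    by exists 0; rewrite amul0l scale0r.
  have [aq|aq] := eqVneq (target a) (target q); last first.
    by exists 0; rewrite munit_neq// amul0l scale0r.
  rewrite munit_mul//; case: eqP => [_|_]; last by exists 0; rewrite scale0r.
  by exists 1; rewrite scale1r.
move: x a b; apply: (@generated_ind D) => //.
- rewrite (_ : mkset D = \bigcap_(ab in [set: sink_path E * sink_path E])
    [set x | exists c : R[i], munit ab.1 ab.1 ** x ** munit ab.2 ab.2 = c *: munit ab.1 ab.2]).
    by apply: closed_bigI => ab _; exact: closed_preimage_line.
  by apply/seteqP; split=> [y Dy [a b] _|y Dy a b]; [exact: Dy|exact: (Dy (a, b) I)].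
- move=> x y Dx Dy a b.
  have [f fx] := boolp.choice (Dx a); have [g gy] := boolp.choice (fun c => Dy c b).
  (* The matrix product, obtained by inserting the unit as the sum of the diagonal units; for c over
     another sink the unit of a and c is 0. *)
  exists (\sum_c if target a == target c then f c * g c else 0).
  rewrite (mul_munit_expand x y) amul_sumr amul_suml scaler_suml.
  apply: eq_bigr => c _.
  rewrite amul_idem_split ?munit_mul ?eqxx// fx gy amulZl amulZr scalerA.
  have [ac|ac] := eqVneq (target a) (target c).
    by rewrite munit_mul// eqxx.
  by rewrite munit_neq// amul0l scaler0 scale0r.
- move=> r x Dx a b; have [c cx] := Dx a b.
  by exists (r * c); rewrite amulZr amulZl cx scalerA.
- move=> x Dx a b; have [c cx] := Dx b a; exists (c^*).
  have -> : munit a a ** star x ** munit b b = star (munit b b ** x ** munit a a).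
    by rewrite starM (starM (munit b b) x) !star_munit amulA.
  by rewrite cx starZ star_munit.
- by move=> v; rewrite (P_sum_munit acyclicE CK); apply: big_ind.
(* [S e] times the diagonal unit of b is the unit of the path e b and b if b starts at the range of
   e, and 0 otherwise. *)
- move=> e; rewrite -(sum_munit_unit (S e)).2 amul_sumr; apply: big_ind => // b _.
  have [be|be] := eqVneq (start b) (rng e); last first.
    rewrite /munit -(S_P CK e) amulA -(amulA (S e)) (P_path_elt CK).
    by rewrite eq_sym (negbTE be) amul0r amul0l.
  have [a [_ ae _]] := sink_path_cons acyclicE be.
  by rewrite /munit amulA -(path_elt_cons P S be ae); exact: Dunit.
Qed.

End Generated.

(** * The path representation *)

Section PathRepresentation.
Variables (R : realType) (E : digraph).
Hypothesis acyclicE : acyclic E.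
Local Notation X := (sink_path E).
Local Notation B := (opmx R #|X|).
Implicit Types (F G : X -> X -> R[i]) (p q : pred X) (a b c : X).

Definition kernel_mx F : B := \matrix_(i, j) F (enum_val i) (enum_val j).

Lemma eq_kernel_mx F G : (forall a b, F a b = G a b) -> kernel_mx F = kernel_mx G.
Proof. by move=> FG; apply/matrixP => i j; rewrite !mxE. Qed.

Lemma kernel_mxM F G :
  kernel_mx F ** kernel_mx G = kernel_mx (fun a b => \sum_c F a c * G c b).
Proof.
apply/matrixP => i j; rewrite !mxE [RHS](reindex_onto enum_val enum_rank)/=.
  by apply: eq_big => [l|l _]; rewrite ?mxE// enum_valK eqxx.
by move=> c _; rewrite enum_rankK.
Qed.

Lemma kernel_mx_star F : star (kernel_mx F) = kernel_mx (fun a b => (F b a)^*).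
Proof. by apply/matrixP => i j; rewrite !mxE. Qed.

Lemma kernel_mxB F G : kernel_mx F - kernel_mx G = kernel_mx (fun a b => F a b - G a b).
Proof. by apply/matrixP => i j; rewrite !mxE. Qed.

Lemma kernel_mx_sum (I : finType) (Q : pred I) (F : I -> X -> X -> R[i]) :
  \sum_(i | Q i) kernel_mx (F i) = kernel_mx (fun a b => \sum_(i | Q i) F i a b).
Proof.
apply/matrixP => i j; rewrite mxE.
rewrite (@summxE R[i] _ _ I (index_enum I) Q (fun i => kernel_mx (F i))).
by apply: eq_bigr => k _; rewrite mxE.
Qed.

Definition diag p : B := kernel_mx (fun a b => ((a == b) && p a)%:R).

Lemma diagM p F : diag p ** kernel_mx F = kernel_mx (fun a b => (p a)%:R * F a b).
Proof.
rewrite kernel_mxM; apply: eq_kernel_mx => a b.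
rewrite (bigD1 a)//= big1 => [|c ca]; first by rewrite eqxx addr0.
by rewrite eq_sym (negbTE ca) mul0r.
Qed.

Lemma diag_mul p q : diag p ** diag q = diag (fun a => p a && q a).
Proof.
rewrite diagM; apply: eq_kernel_mx => a b; rewrite -natrM mulnb.
by rewrite andbCA.
Qed.

Lemma diag_star p : star (diag p) = diag p.
Proof.
rewrite kernel_mx_star; apply: eq_kernel_mx => a b; rewrite rmorph_nat.
by rewrite eq_sym; case: eqP => [->|].
Qed.

Lemma diag0 p : (forall a, ~~ p a) -> diag p = 0.
Proof. by move=> p0; apply/matrixP => i j; rewrite !mxE (negbTE (p0 _)) andbF. Qed.

Definition vproj (v : vertex E) : B := diag (fun a => start a == v).

(** The creation operator on the space with basis the sink paths: on column vectors, b goes to e b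
    when composable and to 0 otherwise. *)
Definition eshift (e : edge E) : B :=
  kernel_mx (fun a b => ((start b == rng e) && (steps a == e :: steps b))%:R).

Lemma eshift_star e : eshift e ** star (eshift e) = diag (fun a => ohead (steps a) == Some e).
Proof.
rewrite kernel_mx_star kernel_mxM; apply: eq_kernel_mx => a b.
case: (eqVneq (ohead (steps a)) (Some e)); last first.
  rewrite andbF => ae; rewrite big1// => c _.
  case: eqP => [_|_]; case: (eqVneq (steps a)) => [ac|_]; rewrite ?mul0r//.
  by rewrite ac eqxx in ae.
rewrite andbT; case ap : (steps a) => [//|f p] [fe]; subst f.
have [c [ce cp _]] := sink_path_tail acyclicE ap.
rewrite (bigD1 c)//= big1 => [|d dc].
  rewrite ce cp !eqxx/= mul1r addr0 rmorph_nat; congr (_%:R); congr nat_of_bool.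
  apply/eqP/eqP => [bp|<-//]; apply: sink_path_eq; last by rewrite ap bp.
  by rewrite (start_cons ap) (start_cons bp).
case: (eqVneq (start d)) => [dr|_]; rewrite ?mul0r//.
rewrite eqseq_cons eqxx /=; case: eqP => [pd|_]; rewrite ?mul0r//.
by case/eqP: dc; apply: sink_path_eq; rewrite ?dr ?ce// cp pd.
Qed.

Lemma star_eshift e : star (eshift e) ** eshift e = vproj (rng e).
Proof.
rewrite kernel_mx_star kernel_mxM; apply: eq_kernel_mx => a b.
have [ae|_] := eqVneq (start a) (rng e); last first.
  by rewrite andbF big1// => c _; rewrite rmorph0 mul0r.
have [c [cs cp _]] := sink_path_cons acyclicE ae.
rewrite (bigD1 c)//= big1 => [|d dc]; last first.
  case: eqP => [dp|_]; last by rewrite rmorph0 mul0r.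
  case/eqP: dc; apply: sink_path_eq; last by rewrite dp cp.
  by rewrite (start_cons dp) (start_cons cp).
rewrite cp eqxx rmorph1 mul1r addr0 andbT eqseq_cons eqxx /=.
congr (_%:R); congr nat_of_bool.
apply/andP/eqP => [[/eqP be /eqP ab]|<-]; last by rewrite ae !eqxx.
by apply: sink_path_eq; rewrite ?ae ?be.
Qed.

Lemma vproj_eshift_CK : is_CK_family vproj eshift.
Proof.
split.
- split=> [v|v w vw].
    split; rewrite ?diag_star// diag_mul.
    by apply: eq_kernel_mx => a b; rewrite andbb.
  by rewrite diag_mul diag0// => a; apply/negP => /andP[/eqP -> /eqP]; apply/eqP.
- split=> [e|e f ef].
    rewrite /is_partial_isometry eshift_star diagM; apply: eq_kernel_mx => a b.
    rewrite -natrM mulnb; congr (_%:R); congr nat_of_bool.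
    by case: eqP => //= ae; apply/esym/negbTE/negP => /andP[_ /eqP ab]; rewrite ab in ae.
  rewrite !eshift_star diag_mul diag0// => a; apply/negP => /andP[/eqP -> /eqP[]].
  exact/eqP.
- exact: star_eshift.
(* The difference is the projection onto the paths from the source of e with first edge other than
   e, or with no edge; a projection is its own star-square. *)
- move=> e; exists (diag (fun a => (start a == src e) && (ohead (steps a) != Some e))).
  rewrite diag_star diag_mul eshift_star kernel_mxB; apply: eq_kernel_mx => a b.
  rewrite andbb; case: (a == b) => /=; last by rewrite subr0.
  case ap : (steps a) => [|f p] /=; first by rewrite andbT subr0.
  have [fe|fe] := eqVneq f e.
    by subst f; rewrite (start_cons ap) !eqxx subrr.
  have -> : (Some f == Some e) = false by apply/negbTE; apply: contra fe => /eqP[->].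
  by rewrite andbT subr0.
- move=> v [e0 e0v]; under eq_bigr do rewrite eshift_star.
  rewrite kernel_mx_sum; apply: eq_kernel_mx => a b.
  case: (a == b) => /=; last by rewrite big1.
  case ap : (steps a) => [|f p] /=.
    rewrite big1// (steps_nil ap); case: eqP => // av.
    by have /forallP/(_ e0) := target_sink a; rewrite av e0v eqxx.
  rewrite (start_cons ap); have [fv|fv] := eqVneq (src f) v.
    rewrite (bigD1 f) ?fv//= eqxx big1 ?addr0// => e /andP[_ ef].
    by rewrite (_ : (_ == _) = false)//; apply/negbTE; apply: contra ef => /eqP[->].
  rewrite big1// => e ev.
  by rewrite (_ : (_ == _) = false)//; apply/negbTE; apply: contra fv => /eqP[->].
Qed.

Lemma vproj_neq0 v : is_sink v -> vproj v != 0.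
Proof.
move=> sv; have [a [av _ _]] := sink_path_nil acyclicE sv.
apply/eqP => /matrixP/(_ (enum_rank a) (enum_rank a)); rewrite !mxE enum_rankK av !eqxx.
by apply/eqP; rewrite oner_eq0.
Qed.

Lemma graph_algebra_sink_neq0 (A : cstarAlgType R[i]) (P : vertex E -> A)
    (S : edge E -> A) v : is_graph_algebra P S -> is_sink v -> P v != 0.
Proof.
move=> [_ _ /(_ _ _ _ vproj_eshift_CK)[phi [phi_hom phiP _]]] sv.
apply: contra (vproj_neq0 sv) => /eqP Pv0.
by rewrite -phiP Pv0 (star_hom0 phi_hom).
Qed.

End PathRepresentation.

(** * Lower bound *)

(** An identity matrix of size [#|Q|] factors through [#|Q'|] coordinates, which bounds its rank. *)
Lemma card_delta_factor (K : fieldType) (T U : finType) (Q : pred T) (Q' : pred U)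
    (F : T -> U -> K) (G : U -> T -> K) :
  (forall a b, Q a -> Q b -> \sum_(u | Q' u) F a u * G u b = (a == b)%:R) ->
  (#|Q| <= #|Q'|)%N.
Proof.
move=> FG.
pose MF : 'M[K]_(#|Q|, #|Q'|) := \matrix_(i, j) F (enum_val i) (enum_val j).
pose MG : 'M[K]_(#|Q'|, #|Q|) := \matrix_(i, j) G (enum_val i) (enum_val j).
apply: (@mulmx1_min _ _ _ MF MG); apply/matrixP => i j; rewrite !mxE.
rewrite -(inj_eq enum_val_inj) -FG; [|exact: (enum_valP i)|exact: (enum_valP j)].
rewrite -[RHS]/(\sum_(u in Q') _) [RHS]big_enum_val.
by apply: eq_bigr => l _; rewrite !mxE.
Qed.

Section Gauge.
Variables (R : realType) (E : digraph) (A : cstarAlgType R[i]).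
Variables (P : vertex E -> A) (S : edge E -> A) (gamma : R[i] -> A -> A).
Hypothesis CK : is_CK_family P S.
Hypothesis gaugeA : is_gauge_action P S gamma.
Implicit Types a b c : sink_path E.
Local Notation munit := (munit P S).
Local Notation path_elt := (path_elt P S).

Lemma gauge_path_elt z a : `|z| = 1 -> gamma z (path_elt a) = z ^+ plen a *: path_elt a.
Proof.
move=> z1; have [hom _ _ gen] := gaugeA; have [_ _ gM _] := hom z z1.
have [gP gS] := gen z z1.
rewrite /path_elt /plen /walk_elt; move: (walk_end _ _) => w.
elim: (steps a) => [|e p IH] /=; first by rewrite gP scale1r.
by rewrite gM gS IH amulZl amulZr scalerA exprS.
Qed.

Lemma gauge_munit z a b : `|z| = 1 ->
  gamma z (munit a b) = (z ^+ plen a * z^* ^+ plen b) *: munit a b.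
Proof.
move=> z1; have [hom _ _ _] := gaugeA; have [_ _ gM gs] := hom z z1.
rewrite /munit gM gs !gauge_path_elt// starZ amulZl amulZr scalerA.
by rewrite rmorphXn.
Qed.

Lemma gauge_munit_diag z a : `|z| = 1 -> gamma z (munit a a) = munit a a.
Proof.
by move=> z1; rewrite gauge_munit// -exprMn -normCK z1 !expr1n scale1r.
Qed.

End Gauge.

Section Coefficients.
Variables (R : realType) (E : digraph) (A : cstarAlgType R[i]).
Variables (P : vertex E -> A) (S : edge E -> A).
Hypothesis acyclicE : acyclic E.
Hypothesis graphA : is_graph_algebra P S.
Implicit Types a b c : sink_path E.
Local Notation munit := (munit P S).

Let CK : is_CK_family P S. Proof. by case: graphA. Qed.
Let genA : cstar_generated_by ([set P v | v in setT] `|` [set S e | e in setT])%classic.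
Proof. by case: graphA. Qed.

(** If a and b have different targets, the unit is 0 and this scalar is arbitrary; hence the
    assumption of equal targets below. *)
Definition coef (x : A) a b : R[i] := projT1 (cid (corner_line acyclicE CK genA x a b)).

Lemma coefP x a b : munit a a ** x ** munit b b = coef x a b *: munit a b.
Proof. by rewrite /coef; case: cid. Qed.

(** The scalar is unique because the unit is nonzero, sink projections being nonzero in the graph
    algebra. *)
Lemma coef_eq x a b (r : R[i]) : target a = target b ->
  munit a a ** x ** munit b b = r *: munit a b -> coef x a b = r.
Proof.
move=> ab; rewrite coefP => /eqP; rewrite -subr_eq0 -scalerBl scaler_eq0 => /orP[].
  by rewrite subr_eq0 => /eqP.
have P0 := graph_algebra_sink_neq0 acyclicE graphA (target_sink a).
by rewrite (negbTE (munit_neq0 CK P0 ab)).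
Qed.

Lemma coef_sum (I : finType) (F : I -> A) a b : target a = target b ->
  coef (\sum_i F i) a b = \sum_i coef (F i) a b.
Proof.
move=> ab; apply: coef_eq => //; rewrite amul_sumr amul_suml scaler_suml.
by apply: eq_bigr => i _; rewrite coefP.
Qed.

Lemma coefM x y a b : target a = target b ->
  coef (x ** y) a b = \sum_(c | target c == target a) coef x a c * coef y c b.
Proof.
move=> ab; apply: coef_eq => //.
rewrite (mul_munit_expand acyclicE CK genA x y) amul_sumr amul_suml scaler_suml.
rewrite [RHS]big_mkcond /=; apply: eq_bigr => c _.
rewrite amul_idem_split ?(munit_mul CK) ?eqxx// !coefP amulZl amulZr scalerA.
have [ac|ac] := eqVneq (target c) (target a).
  by rewrite (munit_mul CK)// eqxx.
by rewrite (munit_neq CK) 1?eq_sym// amul0l scaler0.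
Qed.

Lemma coef_unit u a b : is_unit u -> target a = target b -> coef u a b = (a == b)%:R.
Proof.
move=> uU ab; apply: coef_eq => //; rewrite (uU _).2 (munit_mul CK)//.
by case: eqP => [->|_]; rewrite ?scale1r ?scale0r.
Qed.

Variable gamma : R[i] -> A -> A.
Hypothesis gaugeA : is_gauge_action P S gamma.

(** Diagonal units are gauge invariant, so the action commutes with compression to a corner. *)
Lemma coef_gauge z x a b : `|z| = 1 -> target a = target b ->
  coef (gamma z x) a b = z ^+ plen a * z^* ^+ plen b * coef x a b.
Proof.
move=> z1 ab; apply: coef_eq => //; have [hom _ _ _] := gaugeA.
have [_ gZ gM _] := hom z z1.
rewrite -(gauge_munit_diag gaugeA a z1) -(gauge_munit_diag gaugeA b z1).
by rewrite -!gM coefP gZ (gauge_munit gaugeA)// scalerA mulrC.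
Qed.

End Coefficients.

Section Wave.
Local Open Scope classical_set_scope.
Local Open Scope ring_scope.
Variables (R : realType) (k : nat).
Hypothesis k_gt0 : (0 < k)%N.
Local Notation G := (Zmod k).

(* sqrt(t) tensor the character g |-> w ^ g of Z/k *)
Lemma wave_subproof (w : R[i]) :
  cone_pred (fun x : R * G => if 0 < x.1 <= 1 then (Num.sqrt x.1)%:C%C * w ^+ x.2 else 0).
Proof.
split=> [g|s g /= /negP/negbTE ->//].
have : {within `[0, 1]%classic, continuous (fun s : R => (Num.sqrt s)%:C%C * w ^+ g : R[i]^o)}.
  apply: continuous_subspaceT => s.
  apply: (@cvgM R[i] _ (nbhs s) _ (fun s => (Num.sqrt s)%:C%C) (fun=> w ^+ g)).
    exact: (cvg_comp _ _ (@sqrt_continuous R s) (@real_complex_continuous R _)).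
  exact: cvg_cst.
apply: (@subspace_eq_continuous R `[0, 1]%classic R[i]^o) => s.
rewrite mem_setE in_itv/= => /andP[s0 s1].
rewrite /from_subspace/= s1 andbT; case: ltgtP s0 => // <- _.
by rewrite sqrtr0 mul0r.
Qed.

Definition wave (w : R[i]) : cone R G := mk_cone (wave_subproof w).

Lemma wave_mul (w : R[i]) : w != 0 -> wave w^-1 ** wave w = cone_id R G.
Proof.
move=> w0; apply/val_inj/funext => -[s g] /=; case: ifP => [/andP[s0 _]|_]; last by rewrite mul0r.
rewrite mulrACA -exprMn mulVf// expr1n mulr1 -rmorphM/= -expr2 sqr_sqrtr// ltW//.
Qed.

Lemma cone_act_wave (g : G) (w : R[i]) : w ^+ k = 1 ->
  cone_act g (wave w) = w ^+ g *: wave w.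
Proof.
move=> wk; apply/val_inj/funext => -[s h].
change ((wave w (s, (h * g)%g) : R[i]) = w ^+ g * wave w (s, h)); rewrite /=.
have -> : w ^+ (h * g)%g = w ^+ h * w ^+ g.
  have wk' : w ^+ k.-1.+1 = 1 by rewrite prednK.
  by rewrite -exprD -(expr_mod (h + g) wk').
by case: ifP => _; [rewrite mulrA mulrC|rewrite mulr0].
Qed.

End Wave.

Section LowerBound.
Variables (R : realType) (E : digraph) (k : nat) (zeta : R[i]).
Variables (A : cstarAlgType R[i]) (P : vertex E -> A) (S : edge E -> A).
Variable gamma : R[i] -> A -> A.
Hypotheses (acyclicE : acyclic E) (k_gt0 : (0 < k)%N).
Hypothesis zeta_root : k.-primitive_root zeta.
Hypotheses (graphA : is_graph_algebra P S) (gaugeA : is_gauge_action P S gamma).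
Implicit Types a b c : sink_path E.

Definition residue_class (v : vertex E) (i : nat) : pred (sink_path E) :=
  [pred a | (target a == v) && (plen a == i %[mod k])].

Lemma norm_zeta : `|zeta| = 1.
Proof.
apply/eqP; rewrite -(@pexpr_eq1 _ _ k) ?k_gt0//.
by rewrite -normrX (prim_expr_order zeta_root) normr1.
Qed.

(** The coefficient is scaled in two ways; if it is nonzero the two powers of the primitive root
    agree, hence so do the exponents mod k. *)
Lemma coef_degree x d a b : target a = target b -> gamma zeta x = zeta ^+ d *: x ->
  coef acyclicE graphA x a b != 0 -> (plen a == d + plen b %[mod k])%N.
Proof.
move=> ab xd xab0; rewrite -(eq_prim_root_expr zeta_root).
have zz : zeta * zeta^* = 1 by rewrite -normCK norm_zeta expr1n.
have := coef_gauge acyclicE graphA gaugeA x norm_zeta ab.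
have -> : coef acyclicE graphA (gamma zeta x) a b = zeta ^+ d * coef acyclicE graphA x a b.
  by apply: coef_eq => //; rewrite xd amulZr amulZl coefP scalerA.
move/(mulIf xab0) => /eqP; rewrite eq_sym => /eqP zab.
by rewrite exprD -zab -mulrA -exprMn mulrC (mulrC _^*) zz expr1n mul1r.
Qed.

Lemma wlt_dim_card n v i i' :
  wlt_dim_le (fun j : Zmod k => gamma (zeta ^+ j)) n ->
  (#|residue_class v i| <= n.+1 * #|residue_class v i'|)%N.
Proof.
move=> [rho [rhoP [u uU [y [_ yu]]]]].
(* A natural number representing i' - i mod k, since k - 1 is -1 mod k. *)
pose d := (i' + i * k.-1)%N; pose w := zeta ^+ d.
have z0 : zeta != 0 by rewrite -normr_gt0 norm_zeta ltr01.
have w0 : w != 0 by rewrite expf_neq0.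
have wk : w ^+ k = 1 by rewrite /w exprAC (prim_expr_order zeta_root) expr1n.
pose x j := rho j (wave k w).
have deg j : gamma zeta (x j) = zeta ^+ d *: x j.
  have [[_ rZ _ _] req] := rhoP j.
  (* The exponent is 1 mod k. For k = 1 it is 0, and then r is 1 anyway. *)
  have z1 (r : R[i]) : r ^+ k = 1 -> r ^+ (inZp 1 : Zmod k) = r.
    by move=> rk; rewrite /= prednK// expr_mod.
  rewrite -{1}(z1 zeta (prim_expr_order zeta_root)) -req cone_act_wave//.
  by rewrite rZ z1.
have uE : u = \sum_j (y ** rho j (wave k w^-1)) ** x j.
  rewrite -yu amul_sumr; apply: eq_bigr => j _; have [[_ _ rM _] _] := rhoP j.
  by rewrite -amulA -rM wave_mul.
(* The intermediate index set is n + 1 copies of the class of i': pairs of a map index j and a path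
   c. *)
rewrite -[n.+1]card_ord -cardX.
apply: (@card_delta_factor R[i] _ _ _ _
  (fun a jc => coef acyclicE graphA (y ** rho jc.1 (wave k w^-1)) a jc.2)
  (fun jc b => coef acyclicE graphA (x jc.1) jc.2 b)) => a b.
move=> /andP[/eqP av /eqP ai] /andP[/eqP bv /eqP bi].
have ab : target a = target b by rewrite av bv.
rewrite -(coef_unit acyclicE graphA uU ab) uE coef_sum//.
rewrite (eq_bigl (fun jc : 'I_n.+1 * sink_path E => true && residue_class v i' jc.2)) //.
rewrite -(pair_big_dep xpredT (fun _ c => residue_class v i' c) (fun j c =>
  coef acyclicE graphA (y ** rho j (wave k w^-1)) a c * coef acyclicE graphA (x j) c b)) /=.
apply: eq_bigr => j _; rewrite coefM// av [RHS](bigID (residue_class v i')) /=.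
rewrite [X in _ = _ + X]big1 ?addr0 => [|c /andP[/eqP cv]].
  by apply: eq_bigl => c; rewrite andbA andbb.
(* Since [x j] has degree d and b has residue i, its coefficient at c and b vanishes unless c has
   residue i'. *)
rewrite /residue_class /= cv eqxx /= => ci; apply/eqP; rewrite mulf_eq0; apply/orP; right.
apply: contraNT ci => /(coef_degree (_ : target c = target b) (deg j)).
rewrite cv bv => /(_ erefl) /eqP ->; rewrite -modnDmr bi modnDmr /d.
by rewrite -addnA -mulnSr prednK// addnC modnMDl.
Qed.

End LowerBound.

(** * Upper bound *)

Section UpperBound.
Variables (R : realType) (E : digraph) (k : nat) (zeta : R[i]).
Variables (A : cstarAlgType R[i]) (P : vertex E -> A) (S : edge E -> A).
Variable gamma : R[i] -> A -> A.
Hypotheses (acyclicE : acyclic E) (k_gt0 : (0 < k)%N).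
Hypothesis zeta_root : k.-primitive_root zeta.
Hypotheses (graphA : is_graph_algebra P S) (gaugeA : is_gauge_action P S gamma).
Implicit Types a b c : sink_path E.
Local Notation munit := (munit P S).
Local Notation path_elt := (path_elt P S).
Local Notation G := (Zmod k).

Let CK : is_CK_family P S. Proof. by case: graphA. Qed.
Let genA : cstar_generated_by ([set P v | v in setT] `|` [set S e | e in setT])%classic.
Proof. by case: graphA. Qed.
Let normz : `|zeta| = 1. Proof. exact: norm_zeta zeta_root. Qed.

Lemma conj_zetaM : zeta^* * zeta = 1.
Proof. by rewrite mulrC -normCK normz expr1n. Qed.

(** Orthogonality of characters: a geometric sum whose ratio r satisfies r ^ k = 1, with r = 1 only
    for g = h. *)
Lemma character_sum (g h : G) :
  \sum_(i : G) (zeta ^+ (g * i) * zeta^* ^+ (h * i)) = if g == h then k%:R else 0.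
Proof.
have -> : \sum_(i : G) (zeta ^+ (g * i) * zeta^* ^+ (h * i)) =
    \sum_(i < k.-1.+1) (zeta ^+ g * zeta^* ^+ h) ^+ i.
  by apply: eq_bigr => i _; rewrite exprMn -!exprM.
set r := _ * _; have rh : r * zeta ^+ h = zeta ^+ g.
  by rewrite /r -mulrA -exprMn conj_zetaM expr1n mulr1.
have [gh|gh] := eqVneq g h.
  have -> : r = 1 by rewrite /r gh -exprMn mulrC conj_zetaM expr1n.
  by under eq_bigr do rewrite expr1n; rewrite sumr_const card_ord prednK.
have r1 : r - 1 != 0.
  rewrite subr_eq0; apply: contra gh => /eqP r1; move: rh; rewrite r1 mul1r.
  move/eqP; rewrite (eq_prim_root_expr zeta_root) !modn_small ?(leq_trans (ltn_ord _)) ?prednK//.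
  by move/eqP/val_inj ->.
apply: (mulfI r1); rewrite mulr0 -subrX1 prednK// /r exprMn -!exprM !(mulnC _ k) !exprM.
by rewrite -rmorphXn (prim_expr_order zeta_root) rmorph1 !expr1n mulr1 subrr.
Qed.

Section ConeHom.
Variables (L : finType) (tgt : L -> vertex E) (T : L -> G -> sink_path E).
Hypothesis T_target : forall l i, target (T l i) = tgt l.
Hypothesis T_plen : forall l i, (plen (T l i) = i %[mod k])%N.
Hypothesis T_inj : forall l l' i i', T l i = T l' i' -> l = l' /\ i = i'.
Implicit Types (l : L) (g h i : G).

(** The discrete Fourier transform of the path elements of one family. These vectors are orthogonal
    with square k times a projection, whence the factor 1/k in [cyc_proj]. *)
Definition cyc_elt l g : A := \sum_(i : G) zeta^* ^+ (g * i) *: path_elt (T l i).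
Definition cyc_proj g : A := k%:R^-1 *: \sum_l cyc_elt l g ** star (cyc_elt l g).
(** Evaluation at the endpoint 1 of the cone, followed by the map from C(Z/k) sending the indicator
    of g to [cyc_proj g]. *)
Definition cyc_hom (f : cone R G) : A := \sum_g (f (1, g) : R[i]) *: cyc_proj g.

Lemma star_cyc_elt l l' g h : star (cyc_elt l g) ** cyc_elt l' h =
  if (l == l') && (g == h) then k%:R *: P (tgt l) else 0.
Proof.
rewrite /cyc_elt star_sum amul_suml.
have -> : (if (l == l') && (g == h) then k%:R *: P (tgt l) else 0) =
  \sum_(i : G) if l == l' then (zeta ^+ (g * i) * zeta^* ^+ (h * i)) *: P (tgt l) else 0.
  case: (l == l') => /=; last by rewrite big1.
  by rewrite -scaler_suml character_sum; case: ifP => _; rewrite ?scale0r.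
apply: eq_bigr => i _; rewrite amul_sumr starZ (bigD1 i)//= big1 ?addr0 => [|j ji].
  rewrite amulZl amulZr scalerA (star_path_elt CK) T_target rmorphXn/= conjCK.
  case: (eqVneq l l') => [->|ll']; first by rewrite eqxx.
  by case: eqP => [/T_inj[/eqP]|]; rewrite ?(negbTE ll')// scaler0.
rewrite amulZl amulZr (star_path_elt CK); case: eqP => [/T_inj[_ ij]|]; last by rewrite !scaler0.
by rewrite ij eqxx in ji.
Qed.

Lemma cyc_elt_P l g : cyc_elt l g ** P (tgt l) = cyc_elt l g.
Proof.
rewrite amul_suml; apply: eq_bigr => i _.
by rewrite amulZl (path_elt_P CK) T_target eqxx.
Qed.

Let k0 : k%:R != 0 :> R[i]. Proof. by rewrite pnatr_eq0 -lt0n. Qed.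

Lemma cyc_projM g h : cyc_proj g ** cyc_proj h = if g == h then cyc_proj g else 0.
Proof.
rewrite amulZl amulZr amul_suml.
have -> : \sum_l cyc_elt l g ** star (cyc_elt l g) **
      (\sum_l' cyc_elt l' h ** star (cyc_elt l' h)) =
    \sum_l if g == h then k%:R *: (cyc_elt l g ** star (cyc_elt l g)) else 0.
  apply: eq_bigr => l _; rewrite amul_sumr (bigD1 l)//= big1 ?addr0 => [|l' ll'].
    rewrite amulA -(amulA (cyc_elt l g)) star_cyc_elt eqxx /=.
    case: eqP => [->|]; last by rewrite amul0r amul0l.
    by rewrite amulZr cyc_elt_P amulZl.
  rewrite amulA -(amulA (cyc_elt l g)) star_cyc_elt eq_sym (negbTE ll') /=.
  by rewrite amul0r amul0l.
case: ifP => _; last by rewrite big1 ?scaler0.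
by rewrite -scaler_sumr !scalerA -mulrA mulVf// mulr1.
Qed.

Lemma star_cyc_proj g : star (cyc_proj g) = cyc_proj g.
Proof.
rewrite starZ star_sum fmorphV rmorph_nat; congr (_ *: _).
by apply: eq_bigr => l _; rewrite starM starK.
Qed.

(** The i-th path has length i mod k, so the action multiplies its term by the h i-th power of zeta;
    this lowers the frequency from g + h to g. *)
Lemma gauge_cyc_proj g h : gamma (zeta ^+ h) (cyc_proj (g * h)%g) = cyc_proj g.
Proof.
have zh1 : `|zeta ^+ h| = 1 by rewrite normrX normz expr1n.
have [hom _ _ _] := gaugeA; have hh := hom _ zh1; have [_ gZ gM gs] := hh.
have e l : gamma (zeta ^+ h) (cyc_elt l (g * h)%g) = cyc_elt l g.
  rewrite (star_hom_sum _ _ _ hh); apply: eq_bigr => i _.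
  rewrite gZ (gauge_path_elt gaugeA)// scalerA; congr (_ *: _).
  have zk : zeta ^+ k.-1.+1 = 1 by rewrite prednK// (prim_expr_order zeta_root).
  have czk : zeta^* ^+ k.-1.+1 = 1 by rewrite -rmorphXn zk rmorph1.
  have -> : (zeta ^+ h) ^+ plen (T l i) = zeta ^+ (h * i).
    rewrite -!exprM; apply/eqP; rewrite (eq_prim_root_expr zeta_root).
    by rewrite -modnMmr T_plen modnMmr.
  rewrite exprM (_ : zeta^* ^+ (g * h)%g = zeta^* ^+ (g + h)); last first.
    by rewrite -(expr_mod (g + h) czk).
  by rewrite exprD exprMn -!exprM -mulrA -exprMn conj_zetaM expr1n mulr1.
rewrite gZ (star_hom_sum _ _ _ hh); congr (_ *: _).
by apply: eq_bigr => l _; rewrite gM gs e.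
Qed.

(** Fourier inversion: summing over g kills the off-diagonal units. *)
Lemma sum_cyc_proj : \sum_g cyc_proj g = \sum_l \sum_i munit (T l i) (T l i).
Proof.
rewrite -scaler_sumr exchange_big /= scaler_sumr; apply: eq_bigr => l _.
have -> : \sum_g cyc_elt l g ** star (cyc_elt l g) =
    \sum_(g : G) \sum_(i : G) \sum_(j : G)
      (zeta ^+ (j * g) * zeta^* ^+ (i * g)) *: munit (T l i) (T l j).
  apply: eq_bigr => g _; rewrite amul_suml; apply: eq_bigr => i _.
  rewrite star_sum amul_sumr; apply: eq_bigr => j _.
  rewrite starZ amulZl amulZr scalerA rmorphXn/= conjCK mulrC.
  by rewrite ![(g * _)%N]mulnC.
rewrite exchange_big scaler_sumr; apply: eq_bigr => i _ /=.
rewrite exchange_big /= (bigD1 i)//= [X in _ + X]big1 ?addr0 => [|j ji].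
  by rewrite -scaler_suml character_sum eqxx scalerA mulVf// scale1r.
by rewrite -scaler_suml character_sum (negbTE ji) scale0r.
Qed.

Lemma cyc_hom_is_star_hom : is_star_hom cyc_hom.
Proof.
split=> [f h|r f|f h|f].
- by rewrite -big_split /=; apply: eq_bigr => g _; rewrite -scalerDl.
- by rewrite scaler_sumr; apply: eq_bigr => g _; rewrite [RHS]scalerA.
- rewrite /cyc_hom amul_suml; apply: eq_bigr => g _.
  rewrite amul_sumr (bigD1 g)//= big1 ?addr0 => [|g' gg'].
    by rewrite amulZl amulZr scalerA cyc_projM eqxx.
  by rewrite amulZl amulZr cyc_projM eq_sym (negbTE gg') !scaler0.
- rewrite star_sum; apply: eq_bigr => g _.
  by rewrite starZ star_cyc_proj.
Qed.

Lemma cyc_hom_equivariant : is_equivariant (fun j : G => gamma (zeta ^+ j)) cyc_hom.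
Proof.
move=> h f; have zh1 : `|zeta ^+ h| = 1 by rewrite normrX normz expr1n.
have [hom _ _ _] := gaugeA; have hh := hom _ zh1; have [_ gZ _ _] := hh.
rewrite (star_hom_sum _ _ _ hh) [RHS](reindex_inj (mulIg h)) /=.
by apply: eq_bigr => g _; rewrite gZ gauge_cyc_proj.
Qed.

Lemma cyc_hom_id : cyc_hom (cone_id R G) = \sum_l \sum_i munit (T l i) (T l i).
Proof.
rewrite -sum_cyc_proj; apply: eq_bigr => g _ /=.
by rewrite ltr01 lexx /= scale1r.
Qed.

End ConeHom.

Lemma diag_munit_mul (x y : sink_path E -> R[i]) :
  (\sum_a x a *: munit a a) ** (\sum_a y a *: munit a a) = \sum_a (x a * y a) *: munit a a.
Proof.
rewrite amul_suml; apply: eq_bigr => a _.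
rewrite amul_sumr (bigD1 a)//= big1 ?addr0 => [|b ba].
  by rewrite amulZl amulZr scalerA (munit_mul CK)// eqxx.
by rewrite amulZl amulZr (munit_mul CK)// eq_sym (negbTE ba) !scaler0.
Qed.

Lemma diag_munit_invertible (x : sink_path E -> R[i]) :
  (forall a, x a != 0) -> is_invertible (\sum_a x a *: munit a a).
Proof.
move=> x0; exists (\sum_a munit a a); first exact: sum_munit_unit acyclicE CK genA.
exists (\sum_a (x a)^-1 *: munit a a); rewrite !diag_munit_mul.
by split; apply: eq_bigr => a _; rewrite ?mulfV ?mulVf// scale1r.
Qed.

End UpperBound.

(** * Covering the sink paths by disjoint families *)

Lemma card_residue_class_mod (E : digraph) k (v : vertex E) i :
  #|residue_class k v (i %% k)| = #|residue_class k v i|.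
Proof. by apply: eq_card => a; rewrite !inE /= modn_mod. Qed.

Lemma bigmin_leq_seq (I : eqType) (r : seq I) (F : I -> nat) x j :
  j \in r -> (\big[minn/x]_(i <- r) F i <= F j)%N.
Proof.
elim: r => // i r IH; rewrite inE big_cons => /predU1P[->|/IH]; first exact: geq_minl.
exact: leq_trans (geq_minr _ _).
Qed.

Section Cycles.
Variables (E : digraph) (k n : nat).
Hypothesis k_gt0 : (0 < k)%N.
Implicit Types (a b : sink_path E) (v : vertex E).
Local Notation G := (Zmod k).
Local Notation cls v i := (residue_class (E := E) k v i).
Hypothesis cls_le : forall v, is_sink v -> forall i i', (#|cls v i| <= n.+1 * #|cls v i'|)%N.

(** The block length m at a sink; the value 0 elsewhere leaves no index over other vertices. *)
Definition cyc_num v : nat :=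
  if is_sink v then #|cls v [arg min_(i < (ord0 : G) ) #|cls v i|]| else 0.

Lemma cyc_num_le v i : (cyc_num v <= #|cls v i|)%N.
Proof.
rewrite /cyc_num; case: ifP => // _; case: arg_minnP => // j _ jmin.
have ik : (i %% k < k.-1.+1)%N by rewrite prednK// ltn_mod.
apply: (leq_trans (jmin (Ordinal ik) isT)) => /=.
by rewrite card_residue_class_mod.
Qed.

Lemma cyc_num_ge v i : is_sink v -> (#|cls v i| <= n.+1 * cyc_num v)%N.
Proof. by move=> sv; rewrite /cyc_num sv cls_le. Qed.

Definition cyc_index := {v : vertex E & 'I_(cyc_num v)}.
HB.instance Definition _ := Finite.on cyc_index.

(* The j-th block of m consecutive elements of each residue class, read
   cyclically: blocks 0, ..., n cover the class as its size is at most
   (n + 1) m, and each block has distinct elements as m is at most the size. *)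
Lemma cycles_ex : exists T : 'I_n.+1 -> cyc_index -> G -> sink_path E,
  [/\ forall j l i, target (T j l i) = tag l,
      forall j l i, (plen (T j l i) = i %[mod k])%N,
      forall j l l' i i', T j l i = T j l' i' -> l = l' /\ i = i' &
      forall a, exists jli : 'I_n.+1 * cyc_index * G, T jli.1.1 jli.1.2 jli.2 = a].
Proof.
have ex (x : 'I_n.+1 * cyc_index * G) : exists a,
    [/\ target a = tag x.1.2, (plen a = x.2 %[mod k])%N &
     index a (enum (cls (tag x.1.2) x.2)) =
     ((x.1.1 * cyc_num (tag x.1.2) + tagged x.1.2) %% #|cls (tag x.1.2) x.2|)%N].
  case: x => -[j [v l]] i /=; set d := #|_|.
  have d0 : (0 < d)%N by rewrite (leq_trans _ (cyc_num_le v i))// (leq_ltn_trans _ (ltn_ord l)).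
  have rd : ((j * cyc_num v + l) %% d < d)%N by rewrite ltn_mod.
  exists (enum_val (Ordinal rd : 'I_#|cls v i|)).
  have /andP[/eqP ? /eqP ?] := enum_valP (Ordinal rd : 'I_#|cls v i|); split=> //.
  rewrite /enum_val index_uniq ?enum_uniq// -cardE//.
have [T TP] := boolp.choice ex.
exists (fun j l i => T (j, l, i)); split.
- by move=> j l i; have [] := TP (j, l, i).
- by move=> j l i; have [] := TP (j, l, i).
- move=> j [v l] [v' l'] i i' TT.
  have [/= t1 r1 x1] := TP (j, Tagged _ l, i); have [/= t2 r2 x2] := TP (j, Tagged _ l', i').
  have vv : v = v' by rewrite -t1 TT t2.
  subst v'.
  have ii : i = i'.
    apply/val_inj; have := r2; rewrite -TT r1 !modn_small//.
    - by rewrite (leq_trans (ltn_ord _)) ?prednK.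
    - by rewrite (leq_trans (ltn_ord _)) ?prednK.
  (* The block offset is common to both and cancels; l and l' are below the class size, so the
     congruence is an equality. *)
  subst i'; split=> //; move: x2; rewrite -TT x1 => /eqP; rewrite eqn_modDl.
  rewrite !modn_small ?(leq_trans (ltn_ord _)) ?cyc_num_le// => /eqP/val_inj -> //.
- move=> a; have ik : (plen a %% k < k.-1.+1)%N by rewrite prednK// ltn_mod.
  pose v := target a; pose i : G := Ordinal ik; pose m := cyc_num v.
  have sv : is_sink v := target_sink a.
  have av : a \in cls v i by apply/andP; rewrite /= modn_mod !eqxx.
  pose x := index a (enum (cls v i)).
  have xd : (x < #|cls v i|)%N by rewrite cardE index_mem mem_enum.
  have xm : (x < n.+1 * m)%N by rewrite (leq_trans xd) ?cyc_num_ge.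
  have m0 : (0 < m)%N by move: xm; rewrite lt0n; case: (m) => //; rewrite muln0.
  (* Division of the position x by m gives the block and the place within it. *)
  have jn : (x %/ m < n.+1)%N by rewrite ltn_divLR.
  have lm : (x %% m < cyc_num v)%N by rewrite ltn_mod.
  exists (Ordinal jn, Tagged (fun v => 'I_(cyc_num v)) (Ordinal lm), i) => /=.
  set jli := (_, _, i); have [/= t1 r1 x1] := TP jli.
  have Tv : T jli \in enum (cls v i).
    by rewrite mem_enum; apply/andP; rewrite t1 r1 !eqxx.
  have av' : a \in enum (cls v i) by rewrite mem_enum.
  by rewrite -(nth_index a Tv) x1 -divn_eq modn_small// nth_index.
Qed.

End Cycles.

(** * The dimension in terms of path counts *)

Section WltDim.
Variables (R : realType) (E : digraph) (k : nat) (zeta : R[i]).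
Variables (A : cstarAlgType R[i]) (P : vertex E -> A) (S : edge E -> A).
Variable gamma : R[i] -> A -> A.
Hypotheses (acyclicE : acyclic E) (k_gt0 : (0 < k)%N).
Hypothesis zeta_root : k.-primitive_root zeta.
Hypotheses (graphA : is_graph_algebra P S) (gaugeA : is_gauge_action P S gamma).
Local Notation act := (fun j : Zmod k => gamma (zeta ^+ j)).

Lemma card_wlt_dim n :
  (forall v : vertex E, is_sink v -> forall i i',
     (#|residue_class k v i| <= n.+1 * #|residue_class k v i'|)%N) ->
  wlt_dim_le act n.
Proof.
move=> /(cycles_ex k_gt0)[T [T1 T2 T3 T4]].
exists (fun j => cyc_hom zeta P S (T j)); split=> [j|].
  split; first exact: cyc_hom_is_star_hom (T1 j) (T3 j).
  exact: cyc_hom_equivariant (T2 j).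
(* The sum is diagonal, with entry at a the number of times a is covered; this is positive, so the
   sum is invertible. *)
have -> : \sum_j cyc_hom zeta P S (T j) (cone_id R (Zmod k)) =
    \sum_a (#|[pred x | T x.1.1 x.1.2 x.2 == a]|%:R : R[i]) *: munit P S a a.
  under eq_bigr do rewrite cyc_hom_id//.
  rewrite pair_big pair_big (partition_big (fun x => T x.1.1 x.1.2 x.2) xpredT)//=.
  apply: eq_bigr => a _; rewrite (eq_bigr (fun=> munit P S a a)) => [|x /eqP <-//].
  by rewrite sumr_const scaler_nat.
apply: diag_munit_invertible acyclicE graphA _ _ => a.
rewrite pnatr_eq0 -lt0n; apply/card_gt0P.
by have [x xa] := T4 a; exists x; rewrite inE xa.
Qed.

Lemma wlt_dim_leP n : wlt_dim_le act n <->
  forall v : vertex E, is_sink v -> (max_paths k v <= n.+1 * min_paths k v)%N.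
Proof.
split=> [wn v sv|mm].
  have le i j : (num_paths_to k v i <= n.+1 * num_paths_to k v j)%N.
    rewrite !(num_pathsE acyclicE)//.
    exact: (wlt_dim_card acyclicE k_gt0 zeta_root graphA gaugeA v i j wn).
  apply/bigmax_leqP => i _; rewrite /min_paths.
  apply: (big_ind (fun x => num_paths_to k v i <= n.+1 * x)%N) => // x y xi yi.
  by rewrite /minn; case: ifP.
apply: card_wlt_dim => v sv i i'.
have np j : num_paths_to k v (j %% k) = #|residue_class k v j|.
  by rewrite (num_pathsE acyclicE)// -card_residue_class_mod.
have jk j : (j %% k < k)%N by rewrite ltn_mod.
rewrite -!np (leq_trans (leq_bigmax (Ordinal (jk i)) : _ <= max_paths k v)%N)//.
rewrite (leq_trans (mm v sv))// leq_mul2l orFb /min_paths.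
exact: (bigmin_leq_seq _ _ (mem_index_enum (Ordinal (jk i')))).
Qed.

End WltDim.

Section Quot.
Local Open Scope ereal_scope.
Variables (R : realType) (E : digraph) (k : nat).
Hypotheses (acyclicE : acyclic E) (k_gt0 : (0 < k)%N).
Implicit Types (v : vertex E) (n : nat).

Lemma max_paths_gt0 v : is_sink v -> (0 < max_paths k v)%N.
Proof.
move=> sv; apply: (leq_trans _ (leq_bigmax (Ordinal k_gt0))) => /=.
rewrite (num_pathsE acyclicE)//; apply/card_gt0P.
have [a [_ a0 av]] := sink_path_nil acyclicE sv.
by exists a; rewrite inE /= av eqxx /plen a0 /= eqxx.
Qed.

(** If the minimum is 0, both sides fail, as the maximum counts the path of length 0. Otherwise the
    ceiling is at most n + 1 exactly when the ratio is. *)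
Lemma quot_le v n : is_sink v ->
  (quot R k v - 1 <= n%:R%:E) = (max_paths k v <= n.+1 * min_paths k v)%N.
Proof.
move=> sv; rewrite /quot; case: eqP => [->|/eqP m0].
  by rewrite muln0 leqn0 gtn_eqF// max_paths_gt0.
rewrite -EFinB lee_fin lerBlDr natr1 -[n.+1%:R]/(n.+1%:~R) ler_int.
by rewrite ceil_le_int ler_pdivrMr ?ltr0n ?lt0n// -natrM ler_nat.
Qed.

Lemma quot_nat v : is_sink v -> min_paths k v != 0%N ->
  exists n, quot R k v - 1 = n%:R%:E.
Proof.
move=> sv m0; rewrite /quot (negbTE m0) -EFinB.
have : (0 < Num.ceil ((max_paths k v)%:R / (min_paths k v)%:R : R))%R.
  by rewrite ceil_gt0 divr_gt0// ltr0n ?max_paths_gt0// lt0n.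
case: (Num.ceil _) => [[//|n]|//] _; exists n; congr EFin.
by rewrite -[_%:~R]/(n.+1%:R) -natr1 addrK.
Qed.

End Quot.

(* Z/k acts through an identification j |-> zeta ^+ j with the group of k-th
   roots of unity. *)
Theorem theorem4p1 (R : realType) (E : digraph) (k : nat) (zeta : R[i])
    (A : cstarAlgType R[i]) (P : vertex E -> A) (S : edge E -> A)
    (gamma : R[i] -> A -> A)
    (acyclicE : acyclic E) (k_gt0 : (0 < k)%N)
    (zeta_root : k.-primitive_root zeta)
    (graphA : is_graph_algebra P S) (gaugeA : is_gauge_action P S gamma) :
  wlt_dim (fun j : Zmod k => gamma (zeta ^+ j)) =
  (\big[maxe/0]_(v : vertex E | is_sink v) (quot R k v - 1))%E.
Proof.
apply/eqP; rewrite eq_le; apply/andP; split; last first.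
  apply: le_ereal_inf_tmp => _ [n /(wlt_dim_leP acyclicE k_gt0 zeta_root graphA gaugeA) nP <-].
  apply/bigmax_leP; split=> [|v sv]; first by rewrite lee_fin.
  by rewrite quot_le// nP.
have [[v sv mv0]|m0] := pselect (exists2 v : vertex E, is_sink v & min_paths k v = 0%N).
  suff -> : (\big[maxe/0]_(v : vertex E | is_sink v) (quot R k v - 1))%E = +oo%E by rewrite leey.
  apply/eqP; rewrite -leye_eq; apply: le_trans (le_bigmax_cond _ _ sv).
  by rewrite /quot mv0 eqxx.
(* All quotients being finite, the maximum is a natural number, so it can itself be tested as an
   admissible n. *)
have [n nE] : exists n, (\big[maxe/0]_(v : vertex E | is_sink v) (quot R k v - 1))%E = n%:R%:E.
  apply: (big_ind (fun x => exists n, x = n%:R%:E)).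
  - by exists 0%N.
  - by move=> x y nx ny; rewrite maxEle; case: ifP.
  - by move=> v sv; apply: quot_nat => //; apply: contra_notN m0 => /eqP v0; exists v.
rewrite nE; apply: ereal_inf_lbound; exists n => //.
apply/(wlt_dim_leP acyclicE k_gt0 zeta_root graphA gaugeA) => v sv.
by rewrite -(quot_le R)// -nE; exact: (le_bigmax_cond _ (fun v => quot R k v - 1)%E sv).
Qed.
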